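(* Let $X$ be a locally compact metrizable space, $\phi:X\to X$ a homeomorphism, and $\mathcal A=C_0(X)\times_\phi\mathbb Z_+$ the semicrossed product. Let $A\in\mathcal A$ and write $f_m=E_m(A)\in C_0(X)$ for all $m\in\mathbb Z_+$. Then $A$ is a compact element of $\mathcal A$ if and only if the following conditions are satisfied for all $m,n\in\mathbb Z_+$: (1) for all $l\in\mathbb Z_+$ and all $x\in X_a$, $f_m(\phi^{n+l}(x))\,f_n(x)=0$; (2) $f_m(x)=0$ for all $x\in X_r$; (3) the sequence of functions $\{(f_m\circ\phi^{n+l})\,f_n\}_{l\in\mathbb Z_+}$ is pointwise equicontinuous on $X$, i.e. equicontinuous at every point of $X$.
   Context: $\mathbb Z_+=\{0,1,2,\dots\}$. $X_a$ denotes the set of accumulation points of $X$. A point $x\in X$ is recurrent if there is a strictly increasing sequence $(n_k)_{k\in\mathbb N}$ of natural numbers with $\lim_{k\to\infty}\phi^{n_k}(x)=x$; $X_r$ denotes the set of recurrent points. An element $A$ of $\mathcal A$ is called compact if the map $\mathcal A\to\mathcal A$, $T\mapsto ATA$, is a compact operator. Semicrossed product: $\mathbb Z_+$ acts on $C_0(X)$ (complex-valued continuous functions vanishing at infinity) by the isometric $*$-automorphisms $\alpha^n(f)=f\circ\phi^n$. The Banach space $\ell^1(\mathbb Z_+,C_0(X))$, whose elements are written as formal series $A=\sum_{n\in\mathbb Z_+}U^nf_n$ with norm $\sum_n\|f_n\|$, is a Banach algebra with the multiplication determined by $U^nf\,U^mg=U^{n+m}(\alpha^m(f)g)$. Let $C_0(X)$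 act faithfully on a Hilbert space $\mathcal H_0$. A faithful contractive representation $\pi$ of $\ell^1(\mathbb Z_+,C_0(X))$ on $\mathcal H_0\otimes\ell^2(\mathbb Z_+)$ is defined by $\pi(U^nf)(\xi\otimes e_k)=\alpha^k(f)\xi\otimes e_{k+n}$. The semicrossed product $\mathcal A=C_0(X)\times_\phi\mathbb Z_+$ is the operator-norm closure of the image of $\pi$; one writes $U^nf$ for $\pi(U^nf)$. Fourier coefficients: for $A=\sum_nU^nf_n\in\ell^1(\mathbb Z_+,C_0(X))$ put $E_n(A)=f_n$. The maps $E_n$ are contractive for the operator norm and extend to contractions $E_n:\mathcal A\to C_0(X)$; $E_n(A)$ is the $n$th Fourier coefficient of $A\in\mathcal A$. *)

(* Defs.v *)
From HB Require Import structures.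
From mathcomp Require Import all_boot all_order all_algebra.
From mathcomp Require Import all_classical all_reals all_analysis.
From mathcomp Require Import complex ring.

Set Implicit Arguments.
Unset Strict Implicit.
Unset Printing Implicit Defensive.

Import Order.TTheory GRing.Theory Num.Theory numFieldNormedType.Exports.
Local Open Scope classical_set_scope.
Local Open Scope complex_scope.
Local Open Scope ring_scope.

(* Norms of complex normed spaces take their values in R[i]; [rnorm] is the
   same norm seen as an element of R. *)
Section RealNorm.
Context {R : realType} {V : normedModType R[i]}.

Definition rnorm (v : V) : R := complex.Re `|v|.

Lemma rnormE v : `|v| = (rnorm v)%:C.
Proof. by rewrite RRe_real// ger0_real. Qed.

Lemma rnorm_ge0 v : 0 <= rnorm v.
Proof. by rewrite -ler0c -rnormE. Qed.

Lemma rnorm0 : rnorm 0 = 0.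
Proof. by apply: complexI; rewrite -rnormE normr0. Qed.

Lemma rnorm0_eq0 v : rnorm v = 0 -> v = 0.
Proof. by move=> v0; apply/normr0_eq0; rewrite rnormE v0. Qed.

Lemma rnormD v w : rnorm (v + w) <= rnorm v + rnorm w.
Proof. by rewrite -lecR rmorphD/= -!rnormE ler_normD. Qed.

Lemma rnormN v : rnorm (- v) = rnorm v.
Proof. by rewrite /rnorm normrN. Qed.

Lemma rnormB v w : `|rnorm v - rnorm w| <= rnorm (v - w).
Proof.
have h x y : rnorm x - rnorm y <= rnorm (x - y).
  by rewrite lerBlDr -{1}(subrK y x) rnormD.
by rewrite ler_norml h andbT lerNl opprB -(rnormN (v - w)) opprB h.
Qed.

Lemma rnorm_sum n (F : 'I_n -> V) :
  rnorm (\sum_(i < n) F i) <= \sum_(i < n) rnorm (F i).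
Proof.
elim/big_ind2 : _ => [|x a y b xa yb|//]; first by rewrite rnorm0.
by rewrite (le_trans (rnormD _ _))// lerD.
Qed.

Lemma rnorm_continuous : continuous rnorm.
Proof.
move=> v; apply/(@cvgrPdist_lt _ R^o) => e e0; near=> w.
rewrite (le_lt_trans (rnormB v w))// -ltcR -rnormE.
near: w; apply: cvgr_dist_lt; [exact: cvg_id|by rewrite ltcR].
Unshelve. all: by end_near. Qed.

End RealNorm.

Lemma rnormZ (R : realType) (V : normedModType R[i]) (a : R[i]) (v : V) :
  rnorm (a *: v) = rnorm (a : R[i]^o) * rnorm v.
Proof. by apply: complexI; rewrite rmorphM/= -!rnormE normrZ. Qed.

Lemma rnormM (R : realType) (a b : R[i]^o) :
  rnorm (a * b : R[i]^o) = rnorm a * rnorm b.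
Proof. exact: (@rnormZ R R[i]^o). Qed.

Lemma rnorm_real (R : realType) (a : R) : rnorm (a%:C : R[i]^o) = `|a|.
Proof. by apply: complexI; rewrite -rnormE normc_def/= expr0n addr0 sqrtr_sqr. Qed.

Section SupNorm.
Context {R : realType} {T : Type} {V : normedModType R[i]}.
Implicit Types (D : set T) (f g : T -> V).

Definition supnorm D f : R := sup [set rnorm (f x) | x in D].

Definition bounded_on D f := exists M : R, forall x, D x -> rnorm (f x) <= M.

Lemma supnorm_ge D f x : bounded_on D f -> D x -> rnorm (f x) <= supnorm D f.
Proof.
move=> [M fM] Dx; apply: ub_le_sup; last by exists x.
by exists M => _ [y Dy <-]; exact: fM.
Qed.

Lemma supnorm_le D f (M : R) :
  0 <= M -> (forall x, D x -> rnorm (f x) <= M) -> supnorm D f <= M.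
Proof.
move=> M0 fM; have [->|/set0P[x Dx]] := eqVneq D set0.
  by rewrite /supnorm image_set0 sup0.
by apply: ge_sup; [exists (rnorm (f x)), x|move=> _ [y Dy <-]; exact: fM].
Qed.

Lemma supnorm_ge0 D f : 0 <= supnorm D f.
Proof.
rewrite /supnorm; set E := [set _ | _ in _].
have [[[y Ey] ubE]|/sup_out->//] := pselect (has_sup E).
by apply: le_trans (ub_le_sup ubE Ey); case: Ey => x _ <-; exact: rnorm_ge0.
Qed.

Lemma supnormD D f g : bounded_on D f -> bounded_on D g ->
  supnorm D (f \+ g) <= supnorm D f + supnorm D g.
Proof.
move=> bf bg; apply: supnorm_le => [|x Dx].
  by rewrite addr_ge0// supnorm_ge0.
by rewrite (le_trans (rnormD _ _))// lerD// supnorm_ge.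
Qed.

Lemma supnormZ D f (a : R[i]) : bounded_on D f ->
  supnorm D (fun x => a *: f x) = rnorm (a : R[i]^o) * supnorm D f.
Proof.
move=> bf; apply/eqP; rewrite eq_le; apply/andP; split.
  apply: supnorm_le => [|x Dx]; first by rewrite mulr_ge0 ?rnorm_ge0 ?supnorm_ge0.
  by rewrite rnormZ ler_wpM2l ?rnorm_ge0// supnorm_ge.
have [a0|a0] := eqVneq (rnorm (a : R[i]^o)) 0; first by rewrite a0 mul0r supnorm_ge0.
have ap : 0 < rnorm (a : R[i]^o) by rewrite lt_def a0 rnorm_ge0.
rewrite -ler_pdivlMl//; apply: supnorm_le => [|x Dx].
  by rewrite mulr_ge0 ?invr_ge0 ?rnorm_ge0 ?supnorm_ge0.
rewrite ler_pdivlMl// -rnormZ.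
apply: (supnorm_ge (f := fun x => a *: f x)) => //.
have [M fM] := bf; exists (rnorm (a : R[i]^o) * M) => y Dy.
by rewrite rnormZ ler_wpM2l ?rnorm_ge0// fM.
Qed.

End SupNorm.

Section L2Real.
Context {R : realType}.
Implicit Types a b : R ^nat.

Definition sqsum a : R ^nat := series (fun k => a k ^+ 2).

Lemma sqsum_nd a : nondecreasing_seq (sqsum a).
Proof. by apply/nondecreasing_series => n _ _; exact: sqr_ge0. Qed.

Lemma sqsum_ge0 a N : 0 <= sqsum a N.
Proof. by apply: sumr_ge0 => k _; exact: sqr_ge0. Qed.

Lemma sqsum_le a N : cvgn (sqsum a) -> sqsum a N <= limn (sqsum a).
Proof. by move=> ca; apply: nondecreasing_cvgn_le => //; exact: sqsum_nd. Qed.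

Lemma sqsum_lim_ge0 a : cvgn (sqsum a) -> 0 <= limn (sqsum a).
Proof. by move=> ca; apply: le_trans (sqsum_le 0 ca); exact: sqsum_ge0. Qed.

Lemma sqsum_bounded a (M : R) : (forall N, Num.sqrt (sqsum a N) <= M) ->
  cvgn (sqsum a) /\ Num.sqrt (limn (sqsum a)) <= M.
Proof.
move=> aM; have M0 : 0 <= M by apply: le_trans (aM 0%N); exact: sqrtr_ge0.
have aM2 N : sqsum a N <= M ^+ 2.
  by rewrite -(sqr_sqrtr (sqsum_ge0 a N)) ler_sqr ?nnegrE ?sqrtr_ge0.
have ca : cvgn (sqsum a).
  apply: nondecreasing_is_cvgn; first exact: sqsum_nd.
  by exists (M ^+ 2) => _ [N _ <-].
split=> //; rewrite -(ger0_norm M0) -sqrtr_sqr ler_wsqrtr//.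
by apply: limr_le => //; exact: nearW.
Qed.

Lemma minkowski2 (a b c d : R) : 0 <= a -> 0 <= b -> 0 <= c -> 0 <= d ->
  Num.sqrt ((a + b) ^+ 2 + (c + d) ^+ 2) <=
  Num.sqrt (a ^+ 2 + c ^+ 2) + Num.sqrt (b ^+ 2 + d ^+ 2).
Proof.
move=> a0 b0 c0 d0; set u := Num.sqrt (a ^+ 2 + _); set v := Num.sqrt (b ^+ 2 + _).
have u2 : u ^+ 2 = a ^+ 2 + c ^+ 2 by rewrite sqr_sqrtr// addr_ge0// sqr_ge0.
have v2 : v ^+ 2 = b ^+ 2 + d ^+ 2 by rewrite sqr_sqrtr// addr_ge0// sqr_ge0.
have u0 : 0 <= u := sqrtr_ge0 _; have v0 : 0 <= v := sqrtr_ge0 _.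
have uv : a * b + c * d <= u * v.
  rewrite -ler_sqr ?nnegrE ?addr_ge0 ?mulr_ge0// exprMn u2 v2 -subr_ge0.
  by rewrite [leRHS](_ : _ = (a * d - b * c) ^+ 2) ?sqr_ge0//; ring.
rewrite -(ger0_norm (addr_ge0 u0 v0)) -sqrtr_sqr ler_wsqrtr// -subr_ge0.
rewrite [leRHS](_ : _ = (u * v - (a * b + c * d)) *+ 2); last first.
  by rewrite sqrrD u2 v2; ring.
by rewrite mulrn_wge0// subr_ge0.
Qed.

Lemma sqsum_minkowski a b N : (forall k, 0 <= a k) -> (forall k, 0 <= b k) ->
  Num.sqrt (sqsum (a \+ b) N) <= Num.sqrt (sqsum a N) + Num.sqrt (sqsum b N).
Proof.
move=> a0 b0; elim: N => [|N IH].
  by rewrite /sqsum /series/= !big_geq// sqrtr0 addr0.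
rewrite /sqsum !seriesSr -/(sqsum _) -/(sqsum a) -/(sqsum b).
apply: le_trans (_ : _ <= Num.sqrt ((Num.sqrt (sqsum a N) +
  Num.sqrt (sqsum b N)) ^+ 2 + (a N + b N) ^+ 2)) _.
  rewrite ler_wsqrtr// lerD2r -(sqr_sqrtr (sqsum_ge0 (a \+ b) N)).
  by rewrite ler_sqr ?nnegrE ?addr_ge0 ?sqrtr_ge0.
apply: le_trans (minkowski2 _ _ _ _) _; rewrite ?sqrtr_ge0//.
by rewrite !sqr_sqrtr ?sqsum_ge0.
Qed.

Lemma sqsum_mono a b N : (forall k, 0 <= a k <= b k) -> sqsum a N <= sqsum b N.
Proof.
move=> ab; apply: ler_sum => k _; have /andP[a0 lab] := ab k.
by rewrite ler_sqr ?nnegrE// (le_trans a0).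
Qed.

Lemma sqsum_cst a (c : R) N : 0 <= c ->
  Num.sqrt (sqsum (fun k => c * a k) N) = c * Num.sqrt (sqsum a N).
Proof.
move=> c0; rewrite -{2}(ger0_norm c0) -sqrtr_sqr -sqrtrM ?sqr_ge0//.
congr Num.sqrt; rewrite /sqsum /series/= mulr_sumr.
by apply: eq_bigr => k _; rewrite exprMn.
Qed.

End L2Real.

(* The Hilbert space l^2(Z_+, V) = V (x) l^2(Z_+): the sequence (xi_k)_k stands
   for the sum of the xi_k (x) e_k. *)
Section L2.
Context {R : realType} {V : normedModType R[i]}.
Implicit Types xi : nat -> V.

Definition sq_summable : {pred (nat -> V)} :=
  fun xi => `[< cvgn (sqsum (fun k => rnorm (xi k))) >].

Definition l2norm xi : R := Num.sqrt (limn (sqsum (fun k => rnorm (xi k)))).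

Lemma sq_summableE xi : xi \in sq_summable -> cvgn (sqsum (fun k => rnorm (xi k))).
Proof. by move=> /asboolP. Qed.

Lemma l2norm_ge xi N : xi \in sq_summable ->
  Num.sqrt (sqsum (fun k => rnorm (xi k)) N) <= l2norm xi.
Proof. by move=> /sq_summableE cxi; rewrite ler_wsqrtr// sqsum_le. Qed.

Lemma l2norm_le xi (M : R) :
  (forall N, Num.sqrt (sqsum (fun k => rnorm (xi k)) N) <= M) ->
  xi \in sq_summable /\ l2norm xi <= M.
Proof. by move=> /sqsum_bounded[? ?]; split=> //; exact/asboolP. Qed.

Lemma l2normD xi eta : xi \in sq_summable -> eta \in sq_summable ->
  xi + eta \in sq_summable /\ l2norm (xi + eta) <= l2norm xi + l2norm eta.
Proof.
move=> xiP etaP; apply: l2norm_le => N.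
apply: le_trans (lerD (l2norm_ge N xiP) (l2norm_ge N etaP)).
apply: le_trans (sqsum_minkowski N _ _) => [|k|k]; try exact: rnorm_ge0.
by rewrite ler_wsqrtr// sqsum_mono// => k; rewrite rnorm_ge0 rnormD.
Qed.

Lemma l2normZ_le (a : R[i]) xi : xi \in sq_summable ->
  a *: xi \in sq_summable /\ l2norm (a *: xi) <= rnorm (a : R[i]^o) * l2norm xi.
Proof.
move=> xiP; apply: l2norm_le => N.
apply: le_trans (ler_wpM2l (rnorm_ge0 _) (l2norm_ge N xiP)).
rewrite -sqsum_cst ?rnorm_ge0// ler_wsqrtr// sqsum_mono// => k.
by rewrite rnorm_ge0 -rnormZ lexx.
Qed.

Lemma sq_summable_submod : submod_closed sq_summable.
Proof.
split=> [|a xi eta xiP etaP].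
  apply: (l2norm_le (M := 0) _).1 => N.
  rewrite (_ : sqsum _ N = 0) ?sqrtr0//.
  by apply: big1 => k _; rewrite [X in rnorm X](_ : _ = 0)// rnorm0 expr0n.
by apply: (l2normD _ _).1 => //; apply: (l2normZ_le _ _).1.
Qed.

HB.instance Definition _ :=
  GRing.isSubmodClosed.Build R[i] (nat -> V) sq_summable sq_summable_submod.

Lemma l2norm_coord xi k : xi \in sq_summable -> rnorm (xi k) <= l2norm xi.
Proof.
move=> /l2norm_ge - /(_ k.+1); apply: le_trans.
rewrite -{1}(ger0_norm (rnorm_ge0 (xi k))) -sqrtr_sqr ler_wsqrtr//.
by rewrite /sqsum seriesSr lerDr sqsum_ge0.
Qed.

End L2.

Record ell2 (R : realType) (V : normedModType R[i]) := Ell2 {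
  ell2_val :> nat -> V ;
  ell2_valP : ell2_val \in sq_summable }.

Section Ell2Norm.
Context (R : realType) (V : normedModType R[i]).

HB.instance Definition _ := [isSub for @ell2_val R V].
HB.instance Definition _ := [Choice of ell2 V by <:].
HB.instance Definition _ := [SubChoice_isSubLmodule of ell2 V by <:].

Definition ell2_norm (xi : ell2 V) : R[i] := (l2norm xi)%:C.

Lemma ell2_normD xi eta : ell2_norm (xi + eta) <= ell2_norm xi + ell2_norm eta.
Proof. by rewrite -rmorphD/= lecR (l2normD _ _).2// ell2_valP. Qed.

Lemma ell2_normZ (a : R[i]) xi : ell2_norm (a *: xi) = `|a| * ell2_norm xi.
Proof.
have le (b : R[i]) (eta : ell2 V) : ell2_norm (b *: eta) <= `|b| * ell2_norm eta.
  by rewrite (@rnormE R R[i]^o) -rmorphM/= lecR (l2normZ_le _ _).2// ell2_valP.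
apply/eqP; rewrite eq_le le/=.
have [->|a0] := eqVneq a 0; first by rewrite normr0 mul0r ler0c sqrtr_ge0.
rewrite -ler_pdivlMl ?normr_gt0// -normfV.
by rewrite -{1}(scalerK a0 xi) le.
Qed.

Lemma ell2_norm0_eq0 xi : ell2_norm xi = 0 -> xi = 0.
Proof.
move=> [] xi0; apply/val_inj/funext => k; apply: rnorm0_eq0.
apply/eqP; rewrite eq_le rnorm_ge0 andbT -xi0.
exact: l2norm_coord (ell2_valP xi).
Qed.

HB.instance Definition _ :=
  Lmodule_isNormed.Build R[i] (ell2 V) ell2_normD ell2_normZ ell2_norm0_eq0.

End Ell2Norm.

Lemma rnorm_ell2E (R : realType) (V : normedModType R[i]) (xi : ell2 V) :
  rnorm xi = l2norm xi.
Proof. by []. Qed.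

Section BoundedOperators.
Context {R : realType} {H : normedModType R[i]}.
Implicit Types T : H -> H.

Definition bounded_linear : {pred (H -> H)} := fun T =>
  `[< linear T /\ exists M : R[i], forall x, `|T x| <= M * `|x| >].

Definition unit_ball : set H := [set x | `|x| <= 1].

Lemma bounded_linearP T : T \in bounded_linear <->
  linear T /\ exists2 M : R, 0 <= M & forall x, rnorm (T x) <= M * rnorm x.
Proof.
split=> [/asboolP[lT [M TM]]|[lT [M M0 TM]]].
  split=> //; exists (rnorm (M : R[i]^o)) => [|x]; first exact: rnorm_ge0.
  rewrite -lecR rmorphM/= -!rnormE.
  have := TM x; have [->|x0] := eqVneq x 0; first by rewrite !normr0 !mulr0.
  move=> /le_trans; apply; rewrite ler_pM2r ?normr_gt0//.
  have := le_trans (normr_ge0 _) (TM x).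
  by rewrite pmulr_lge0 ?normr_gt0// => /ger0_norm ->.
apply/asboolP; split=> //; exists M%:C => x.
by rewrite !rnormE -rmorphM/= lecR.
Qed.

Lemma bounded_on_unit_ball T : T \in bounded_linear -> bounded_on unit_ball T.
Proof.
move=> /bounded_linearP[_ [M M0 TM]]; exists M => x x1.
apply: le_trans (TM x) _; rewrite ler_piMr//.
by rewrite -lecR -rnormE.
Qed.

Lemma bounded_linear_submod : submod_closed bounded_linear.
Proof.
split=> [|a S T /bounded_linearP[lS [M M0 SM]] /bounded_linearP[lT [N N0 TN]]].
  apply/bounded_linearP; split=> [b x y|]; first by rewrite scaler0 addr0.
  by exists 0 => // x; rewrite rnorm0 mul0r.
apply/bounded_linearP; split=> [b x y|].
  rewrite !fctE lS lT !scalerDr !scalerA (mulrC a b) !addrA; congr (_ + _).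
  by rewrite -!addrA (addrC (a *: S y)).
exists (rnorm (a : R[i]^o) * M + N) => [|x].
  by rewrite addr_ge0// mulr_ge0// rnorm_ge0.
rewrite mulrDl -mulrA (le_trans (rnormD _ _))// lerD// rnormZ.
by rewrite ler_wpM2l ?rnorm_ge0.
Qed.

HB.instance Definition _ :=
  GRing.isSubmodClosed.Build R[i] (H -> H) bounded_linear bounded_linear_submod.

End BoundedOperators.

Record bop (R : realType) (H : normedModType R[i]) := Bop {
  bop_val :> H -> H ;
  bop_valP : bop_val \in bounded_linear }.

Section BopNorm.
Context (R : realType) (H : normedModType R[i]).

HB.instance Definition _ := [isSub for @bop_val R H].
HB.instance Definition _ := [Choice of bop H by <:].
HB.instance Definition _ := [SubChoice_isSubLmodule of bop H by <:].

Lemma bop_linear (T : bop H) : linear T.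
Proof. by have /bounded_linearP[] := bop_valP T. Qed.

HB.instance Definition _ (T : bop H) :=
  GRing.isLinear.Build R[i] H H *:%R (bop_val T) (bop_linear T).

Definition bop_norm (T : bop H) : R[i] := (supnorm unit_ball T)%:C.

Lemma bop_normD S T : bop_norm (S + T) <= bop_norm S + bop_norm T.
Proof. by rewrite -rmorphD/= lecR supnormD//; exact/bounded_on_unit_ball/bop_valP. Qed.

Lemma bop_normZ (a : R[i]) T : bop_norm (a *: T) = `|a| * bop_norm T.
Proof.
rewrite (@rnormE R R[i]^o) -rmorphM/= -supnormZ//.
exact/bounded_on_unit_ball/bop_valP.
Qed.

Lemma supnorm_bop (T : bop H) x : rnorm (T x) <= supnorm unit_ball T * rnorm x.
Proof.
have [->|x0] := eqVneq x 0; first by rewrite linear0 rnorm0 mulr0.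
have rx0 : 0 < rnorm x by rewrite -ltcR -rnormE normr_gt0.
have -> : x = (rnorm x)%:C *: ((rnorm x)^-1%:C *: x).
  by rewrite scalerA -rmorphM/= divff ?gt_eqF// scale1r.
rewrite linearZ !(rnormZ (rnorm x)%:C) mulrCA ler_wpM2l ?rnorm_ge0//.
have u1 : rnorm ((rnorm x)^-1%:C *: x) = 1.
  by rewrite rnormZ rnorm_real ger0_norm ?invr_ge0 ?rnorm_ge0// mulVf ?gt_eqF.
rewrite u1 mulr1; apply: supnorm_ge; first exact/bounded_on_unit_ball/bop_valP.
by rewrite /unit_ball/= rnormE u1.
Qed.

Lemma bop_norm0_eq0 T : bop_norm T = 0 -> T = 0.
Proof.
move=> [] T0; apply/val_inj/funext => x; apply: rnorm0_eq0.
by apply/eqP; rewrite eq_le rnorm_ge0 andbT (le_trans (supnorm_bop _ _))// T0 mul0r.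
Qed.

HB.instance Definition _ :=
  Lmodule_isNormed.Build R[i] (bop H) bop_normD bop_normZ bop_norm0_eq0.

Lemma rnorm_bopE (T : bop H) : rnorm T = supnorm unit_ball T.
Proof. by []. Qed.

Lemma rnorm_bop (T : bop H) x : rnorm (T x) <= rnorm T * rnorm x.
Proof. exact: supnorm_bop. Qed.

Lemma rnorm_bop_le (T : bop H) (M : R) :
  0 <= M -> (forall x, rnorm (T x) <= M * rnorm x) -> rnorm T <= M.
Proof.
move=> M0 TM; rewrite rnorm_bopE supnorm_le// => x x1.
by rewrite (le_trans (TM x))// ler_piMr// -lecR -rnormE.
Qed.

Lemma bop_comp_subproof (S T : bop H) : S \o T \in bounded_linear.
Proof.
apply/bounded_linearP; split=> [a x y|]; first by rewrite /= !linearP.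
exists (rnorm S * rnorm T) => [|x]; first by rewrite mulr_ge0 ?rnorm_ge0.
rewrite -mulrA (le_trans (rnorm_bop _ _))//.
by rewrite ler_wpM2l ?rnorm_ge0// rnorm_bop.
Qed.

Definition bop_comp (S T : bop H) : bop H := Bop (bop_comp_subproof S T).

End BopNorm.

Record homeomorphism (X : topologicalType) := Homeomorphism {
  homeo_fun :> X -> X ;
  homeo_inv : X -> X ;
  homeo_funK : cancel homeo_fun homeo_inv ;
  homeo_invK : cancel homeo_inv homeo_fun ;
  homeo_continuous : continuous homeo_fun ;
  homeo_inv_continuous : continuous homeo_inv }.

Section VanishingAtInfinity.
Context {R : realType} {X : topologicalType}.
Implicit Types f g : X -> R[i]^o.

Definition vanishes_at_infinity f := forall e : R[i], 0 < e ->
  exists2 K : set X, compact K & forall x, ~ K x -> `|f x| < e.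

Definition C0_pred : {pred (X -> R[i]^o)} := fun f =>
  `[< continuous f /\ vanishes_at_infinity f >].

Lemma C0_predP f : f \in C0_pred <-> continuous f /\ forall e : R, 0 < e ->
  exists2 K : set X, compact K & forall x, ~ K x -> rnorm (f x) < e.
Proof.
split=> [/asboolP[cf f0]|[cf f0]]; [split=> // e e0|apply/asboolP; split=> // e].
  have [|K cK fK] := f0 e%:C; first by rewrite ltcR.
  by exists K => // x /fK; rewrite rnormE ltcR.
move=> e0; have eE : e = (complex.Re e)%:C by rewrite RRe_real ?gtr0_real.
have [|K cK fK] := f0 (complex.Re e); first by rewrite -ltcR -eE.
by exists K => // x /fK; rewrite rnormE eE ltcR.
Qed.

Lemma C0_bounded f : f \in C0_pred -> bounded_on setT f.
Proof.
move=> /C0_predP[cf /(_ 1 ltr01)[K cK fK]].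
have : compact ((fun x => rnorm (f x)) @` K).
  apply: continuous_compact => //; apply: continuous_subspaceT => x.
  exact: continuous_comp (cf x) (@rnorm_continuous _ _ _).
move=> /(@compact_bounded R R^o)[M [_ /(_ (M + 1))]].
rewrite ltrDl ltr01 => /(_ isT) bM; exists (Num.max (M + 1) 1) => x _.
have [Kx|/fK/ltW xK] := pselect (K x).
  have /= := bM _ (ex_intro2 _ _ x Kx erefl).
  by rewrite le_max ger0_norm ?rnorm_ge0// => ->.
by rewrite le_max xK orbT.
Qed.

Lemma C0_submod : submod_closed C0_pred.
Proof.
split=> [|a f g /C0_predP[cf f0] /C0_predP[cg g0]].
  apply/C0_predP; split=> [x|e e0]; first exact: cvg_cst.
  by exists set0; [exact: compact0|move=> x _; rewrite rnorm0].
apply/C0_predP; split=> [x|e e0].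
  by apply: cvgD; [apply: cvgZr; exact: cf|exact: cg].
set c := rnorm (a : R[i]^o) + 1.
have c0 : 0 < c by rewrite ltr_wpDl ?rnorm_ge0.
have [|K cK fK] := f0 (e / 2 / c); first by rewrite !divr_gt0.
have [|L cL gL] := g0 (e / 2); first by rewrite !divr_gt0.
exists (K `|` L) => [|x /not_orP[/fK fx /gL gx]]; first exact: compactU.
rewrite (le_lt_trans (rnormD _ _))// (splitr e) ltr_leD//; last exact: ltW.
rewrite rnormZ; apply: le_lt_trans (_ : _ <= c * rnorm (f x)) _.
  by rewrite ler_wpM2r ?rnorm_ge0// lerDl.
by rewrite -ltr_pdivlMl// mulrC.
Qed.

HB.instance Definition _ :=
  GRing.isSubmodClosed.Build R[i] (X -> R[i]^o) C0_pred C0_submod.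

End VanishingAtInfinity.

Record C0 (R : realType) (X : topologicalType) := MkC0 {
  C0_val :> X -> R[i]^o ;
  C0_valP : C0_val \in C0_pred }.

Section C0Algebra.
Context (R : realType) (X : topologicalType).

HB.instance Definition _ := [isSub for @C0_val R X].
HB.instance Definition _ := [Choice of C0 R X by <:].
HB.instance Definition _ := [SubChoice_isSubLmodule of C0 R X by <:].

Implicit Types f g : C0 R X.

Definition C0_norm f : R[i] := (supnorm setT f)%:C.

Lemma C0_normD f g : C0_norm (f + g) <= C0_norm f + C0_norm g.
Proof. by rewrite -rmorphD/= lecR supnormD//; exact/C0_bounded/C0_valP. Qed.

Lemma C0_normZ (a : R[i]) f : C0_norm (a *: f) = `|a| * C0_norm f.
Proof.
rewrite (@rnormE R R[i]^o) -rmorphM/= -supnormZ//.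
exact/C0_bounded/C0_valP.
Qed.

Lemma supnorm_C0 f x : rnorm (f x) <= supnorm setT f.
Proof. by apply: supnorm_ge => //; exact/C0_bounded/C0_valP. Qed.

Lemma C0_norm0_eq0 f : C0_norm f = 0 -> f = 0.
Proof.
move=> [] f0; apply/val_inj/funext => x; apply: rnorm0_eq0.
by apply/eqP; rewrite eq_le rnorm_ge0 andbT -f0 supnorm_C0.
Qed.

HB.instance Definition _ :=
  Lmodule_isNormed.Build R[i] (C0 R X) C0_normD C0_normZ C0_norm0_eq0.

Lemma rnorm_C0E f : rnorm f = supnorm setT f.
Proof. by []. Qed.

Lemma rnorm_C0 f x : rnorm (f x) <= rnorm f.
Proof. exact: supnorm_C0. Qed.

Lemma C0_mul_subproof f g : (fun x => f x * g x : R[i]^o) \in C0_pred.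
Proof.
have /C0_predP[cf _] := C0_valP f; have /C0_predP[cg g0] := C0_valP g.
apply/C0_predP; split=> [x|e e0]; first by apply: cvgM; [exact: cf|exact: cg].
set c := rnorm f + 1; have c0 : 0 < c by rewrite ltr_wpDl ?rnorm_ge0.
have [|K cK gK] := g0 (e / c); first by rewrite divr_gt0.
exists K => // x /gK gx; rewrite rnormM.
apply: le_lt_trans (_ : _ <= c * rnorm (g x)) _.
  by rewrite ler_wpM2r ?rnorm_ge0// (le_trans (rnorm_C0 _ _))// lerDl.
by rewrite -ltr_pdivlMl// mulrC.
Qed.

Definition C0_mul f g : C0 R X := MkC0 (C0_mul_subproof f g).

Lemma C0_conj_subproof f : (fun x => Num.conj (f x) : R[i]^o) \in C0_pred.
Proof.
have nconj (z : R[i]^o) : rnorm (Num.conj z : R[i]^o) = rnorm z.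
  by apply: complexI; rewrite -!rnormE norm_conjC.
have /C0_predP[cf f0] := C0_valP f; apply/C0_predP; split=> [x|e e0].
  apply/cvgrPdist_lt => e e0; near=> y.
  rewrite -rmorphB norm_conjC; near: y.
  by have /cvgrPdist_lt := cf x; exact.
by have [K cK fK] := f0 e e0; exists K => // x /fK; rewrite nconj.
Unshelve. all: by end_near. Qed.

Definition C0_conj f : C0 R X := MkC0 (C0_conj_subproof f).

Lemma C0_comp_subproof (phi : homeomorphism X) f : f \o phi \in C0_pred.
Proof.
have /C0_predP[cf f0] := C0_valP f; apply/C0_predP; split=> [x|e e0].
  exact: continuous_comp (@homeo_continuous _ phi x) (cf _).
have [K cK fK] := f0 e e0; exists (homeo_inv phi @` K) => [|x Kx].
  apply: continuous_compact => //; apply: continuous_subspaceT => x.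
  exact: homeo_inv_continuous.
by apply: fK => Kpx; apply: Kx; exists (phi x) => //; exact: homeo_funK.
Qed.

(* alpha(f) = f \o phi, so that alpha^n is [iter n (alpha phi)]. *)
Definition alpha (phi : homeomorphism X) f : C0 R X :=
  MkC0 (C0_comp_subproof phi f).

Lemma iter_alphaE phi n f x : iter n (alpha phi) f x = f (iter n phi x).
Proof. by elim: n x => //= n IH x; rewrite IH -iterSr. Qed.

Lemma rnorm_iter_alpha phi n f : rnorm (iter n (alpha phi) f) <= rnorm f.
Proof.
rewrite rnorm_C0E supnorm_le ?rnorm_ge0// => x _.
by rewrite iter_alphaE rnorm_C0.
Qed.

End C0Algebra.

(* On a complete H, this is a Hilbert space structure with the given norm. *)
Record hilbert_dot (R : realType) (H : normedModType R[i]) := HilbertDot {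
  hdot :> {dot H for (@Num.conj R[i])} ;
  hdotE : forall x : H, hdot x x = `|x| ^+ 2 }.

(* Only injectivity is assumed: contractivity is proved in [rep_contractive],
   and nondegeneracy is not required. *)
Record faithful_rep (R : realType) (X : topologicalType)
    (H0 : normedModType R[i]) (dot : hilbert_dot H0) := FaithfulRep {
  rep_val :> C0 R X -> bop H0 ;
  rep_linear : linear rep_val ;
  rep_mul : forall f g, rep_val (C0_mul f g) = bop_comp (rep_val f) (rep_val g) ;
  rep_adj : forall f x y,
    dot (rep_val f x) y = dot x (rep_val (C0_conj f) y) ;
  rep_inj : injective rep_val }.

Section RepContractive.
Context {R : realType} {X : topologicalType} {H0 : normedModType R[i]}.
Context {dot : hilbert_dot H0} (rho : faithful_rep X dot).
Implicit Types f g k : C0 R X.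

HB.instance Definition _ :=
  GRing.isLinear.Build R[i] (C0 R X) (bop H0) *:%R rho (rep_linear rho).

Lemma C0_sqrt_defect f : (forall x, rnorm (f x) <= 1) ->
  exists2 k, C0_conj k = k & C0_mul (C0_conj f) f = k + k - C0_mul k k.
Proof.
move=> f1; pose r x : R := 1 - Num.sqrt (1 - rnorm (f x) ^+ 2).
have f2 x : 0 <= 1 - rnorm (f x) ^+ 2 <= 1.
  by rewrite subr_ge0 expr_le1 ?rnorm_ge0// f1 gerBl sqr_ge0.
have r0 x : 0 <= r x.
  have /andP[? ?] := f2 x.
  by rewrite subr_ge0 -[leRHS]sqrtr1 ler_wsqrtr.
have rf x : r x <= rnorm (f x).
  have /andP[p q] := f2 x; have := f1 x; have := rnorm_ge0 (f x).
  move: p q; rewrite /r; set t := rnorm (f x) => p q t0 t1.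
  rewrite lerBlDr -lerBlDl -(ger0_norm (_ : 0 <= 1 - t)) ?subr_ge0//.
  rewrite -sqrtr_sqr ler_wsqrtr// -subr_ge0.
  rewrite [leRHS](_ : _ = t * (1 - t) *+ 2); last by ring.
  by rewrite mulrn_wge0// mulr_ge0// subr_ge0.
have /C0_predP[cf f0] := C0_valP f.
have kP : (fun x => (r x)%:C : R[i]^o) \in C0_pred.
  apply/C0_predP; split=> [x|e e0]; last first.
    have [K cK fK] := f0 e e0; exists K => // x /fK; apply: le_lt_trans.
    by rewrite rnorm_real ger0_norm.
  have cr : {for x, continuous (r : X -> R^o)}.
    apply: cvgB; first exact: cvg_cst.
    apply: (@continuous_comp _ R^o R^o (fun y => 1 - rnorm (f y) ^+ 2) Num.sqrt);
      last exact: sqrt_continuous.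
    apply: (@cvgB R R^o); first exact: cvg_cst.
    have cn : (fun y => rnorm (f y) : R^o) @ x --> (rnorm (f x) : R^o).
      exact: continuous_comp (cf x) (@rnorm_continuous _ _ _).
    by under eq_fun do rewrite expr2; rewrite expr2; apply: cvgM.
  apply/cvgrPdist_lt => e e0.
  have eE : e = (complex.Re e)%:C by rewrite RRe_real ?gtr0_real.
  near=> y.
  rewrite -rmorphB (@rnormE R R[i]^o) rnorm_real eE ltcR; near: y.
  by move/(@cvgrPdist_lt _ R^o) : cr; apply; rewrite -ltcR -eE.
exists (MkC0 kP).
  by apply/val_inj/funext => x /=; exact: conjc_real.
apply/val_inj/funext => x /=.
rewrite !fctE/= mulrC -normCK (rnormE (f x)) -!rmorphM -!rmorphD -rmorphB -rmorphXn.
congr (_%:C).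
have /andP[p _] := f2 x; have := sqr_sqrtr p; rewrite /r.
set s := Num.sqrt _ => s2; rewrite [LHS](_ : _ = 1 - s ^+ 2); last by rewrite s2; ring.
by ring.
Unshelve. all: by end_near. Qed.

Lemma rep_contractive_unit f x : (forall x, rnorm (f x) <= 1) ->
  rnorm (rho f x) <= rnorm x.
Proof.
move=> /C0_sqrt_defect[k kk fk].
have h : `|rho f x| ^+ 2 = `|x| ^+ 2 - `|x - rho k x| ^+ 2.
  rewrite -!(hdotE dot) rep_adj.
  have -> : rho (C0_conj f) (rho f x) = rho (C0_mul (C0_conj f) f) x.
    by rewrite rep_mul.
  have -> : rho (C0_mul (C0_conj f) f) x = rho k x + rho k x - rho k (rho k x).
    by rewrite fk linearB linearD/= rep_mul.
  rewrite !linearBl/= !linearBr/= linearDr/= !rep_adj kk.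
  by rewrite !opprB !opprD; ring.
rewrite -lecR -!rnormE -ler_sqr ?nnegrE// h.
by rewrite gerBl exprn_ge0.
Qed.

Lemma rep_contractive f : rnorm (rho f) <= rnorm f.
Proof.
apply: rnorm_bop_le => [|x]; first exact: rnorm_ge0.
have [/rnorm0_eq0 ->|f0] := eqVneq (rnorm f) 0.
  by rewrite rnorm0 mul0r linear0 rnorm0.
have fp : 0 < rnorm f by rewrite lt_def f0 rnorm_ge0.
have -> : f = (rnorm f)%:C *: ((rnorm f)^-1%:C *: f).
  by rewrite scalerA -rmorphM/= divff// scale1r.
rewrite linearZ [X in rnorm X](_ : _ = (rnorm f)%:C *: (rho ((rnorm f)^-1%:C *: f) x))//.
rewrite !(rnormZ (rnorm f)%:C) rnorm_real (ger0_norm (ltW fp)).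
have u : rnorm ((rnorm f)^-1%:C *: f) = 1.
  by rewrite rnormZ rnorm_real ger0_norm ?invr_ge0 ?rnorm_ge0// mulVf.
rewrite u mulr1 ler_wpM2l ?rnorm_ge0// rep_contractive_unit// => y.
by rewrite -u rnorm_C0.
Qed.

End RepContractive.

(* B : ell1 stands for the formal series sum_n U^n (B n). *)
Record ell1 (R : realType) (X : topologicalType) := Ell1 {
  ell1_val :> nat -> C0 R X ;
  ell1_valP : cvgn (series (fun n => rnorm (ell1_val n))) }.

Section SemicrossedProduct.
Context {R : realType} {X : topologicalType} (phi : homeomorphism X).
Context {H0 : normedModType R[i]} {dot : hilbert_dot H0}.
Context (rho : faithful_rep X dot).

(* Since pi(U^n f)(xi (x) e_k) = alpha^k(f) xi (x) e_(k + n), the j-th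
   coordinate of pi(B) xi collects the terms with n + k = j. *)
Definition pi_fun (B : ell1 R X) (xi : nat -> H0) (j : nat) : H0 :=
  \sum_(n < j.+1) rho (iter (j - n) (alpha phi) (B n)) (xi (j - n)%N).

Definition pi_shift (B : ell1 R X) (xi : nat -> H0) (n j : nat) : H0 :=
  if (n <= j)%N then rho (iter (j - n) (alpha phi) (B n)) (xi (j - n)%N) else 0.

Lemma pi_shift_sqsum B (xi : ell2 H0) n N :
  Num.sqrt (sqsum (fun j => rnorm (pi_shift B xi n j)) N) <=
  rnorm (B n) * rnorm xi.
Proof.
apply: le_trans (ler_wpM2l (rnorm_ge0 _) (l2norm_ge N (ell2_valP xi))).
rewrite -sqsum_cst ?rnorm_ge0// ler_wsqrtr//.
have [Nn|nN] := leqP N n.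
  rewrite (_ : sqsum _ N = 0) ?sqsum_ge0//.
  rewrite /sqsum /series/= big_nat big1// => j /= jN.
  by rewrite /pi_shift leqNgt (leq_trans jN)// rnorm0 expr0n.
have -> : sqsum (fun j => rnorm (pi_shift B xi n j)) N =
          sqsum (fun j => rnorm (pi_shift B xi n (j + n)%N)) (N - n)%N.
  rewrite /sqsum /series/= (big_cat_nat (n := n))//=; last exact: ltnW.
  rewrite big_nat big1 ?add0r => [|j jn]; last first.
    by rewrite /pi_shift leqNgt (andP jn).2 rnorm0 expr0n.
  by rewrite -{1}(add0n n) big_addn.
apply: le_trans (_ : _ <= sqsum (fun k => rnorm (B n) * rnorm (xi k)) (N - n)%N) _.
  apply: sqsum_mono => j; rewrite rnorm_ge0/= /pi_shift leq_addl addnK.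
  apply: le_trans (rnorm_bop _ _) _; rewrite ler_wpM2r ?rnorm_ge0//.
  exact: le_trans (rep_contractive _ _) (rnorm_iter_alpha _ _ _).
by apply: sqsum_nd; exact: leq_subr.
Qed.

Lemma pi_fun_sqsum B (xi : ell2 H0) N :
  Num.sqrt (sqsum (fun j => rnorm (pi_fun B xi j)) N) <=
  limn (series (fun n => rnorm (B n))) * rnorm xi.
Proof.
have nd : nondecreasing_seq (series (fun n => rnorm (B n))).
  by apply/nondecreasing_series => n _ _; exact: rnorm_ge0.
have := nondecreasing_cvgn_le nd (@ell1_valP _ _ B) N.
move=> /(ler_wpM2r (rnorm_ge0 xi)); apply: le_trans.
rewrite /series/= mulr_suml.
have -> : sqsum (fun j => rnorm (pi_fun B xi j)) N =
    sqsum (fun j => rnorm (\sum_(0 <= n < N) pi_shift B xi n j)) N.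
  rewrite /sqsum /series/= !big_nat; apply: eq_bigr => j /= jN.
  rewrite (big_cat_nat (n := j.+1))//= [X in _ + X]big_nat.
  rewrite [X in _ + X]big1 ?addr0 => [|n /andP[jn _]]; last first.
    by rewrite /pi_shift leqNgt jn.
  rewrite big_mkord; congr (rnorm _ ^+ 2); apply: eq_bigr => n _.
  by rewrite /pi_shift -ltnS ltn_ord.
elim: {1 3}N => [|M IH].
  rewrite big_geq// (_ : sqsum _ N = 0) ?sqrtr0//.
  by rewrite /sqsum /series/= big1// => j _; rewrite big_geq// rnorm0 expr0n.
rewrite big_nat_recr//=; apply: le_trans (lerD IH (pi_shift_sqsum B xi M N)).
apply: le_trans (sqsum_minkowski N _ _) => [|k|k]; try exact: rnorm_ge0.
rewrite ler_wsqrtr// sqsum_mono// => j.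
by rewrite rnorm_ge0/= big_nat_recr//= rnormD.
Qed.

Definition pi_ell2 B (xi : ell2 H0) : ell2 H0 :=
  Ell2 (l2norm_le (pi_fun_sqsum B xi)).1.

Lemma pi_ell2_bounded B : pi_ell2 B \in bounded_linear.
Proof.
apply/bounded_linearP; split=> [a xi eta|].
  apply/val_inj/funext => j; rewrite /= !fctE /pi_fun scaler_sumr -big_split/=.
  by apply: eq_bigr => n _; rewrite linearP.
exists (limn (series (fun n => rnorm (B n)))) => [|xi].
  apply: limr_ge; first exact: ell1_valP.
  by apply: nearW => N; apply: sumr_ge0 => n _; exact: rnorm_ge0.
exact: (l2norm_le (pi_fun_sqsum B xi)).2.
Qed.

Definition pi_rep (B : ell1 R X) : bop (ell2 H0) := Bop (pi_ell2_bounded B).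

Definition semicrossed : set (bop (ell2 H0)) := closure (range pi_rep).

(* E_m is the extension by continuity of the map sending the formal series B
   to B m: the limit of B m in C_0(X) as pi(B) tends to A. *)
Definition fourier_coef (m : nat) (A : bop (ell2 H0)) : C0 R X :=
  lim ((fun B : ell1 R X => B m) @
       filter_from (nbhs A) (fun V => pi_rep @^-1` V)).

End SemicrossedProduct.

(* T is meant to be linear on the subspace E of V. When T maps E into a closed
   subspace F of W, relative compactness in F and in W agree; this is the case
   below, where E = F is the semicrossed product, closed in B(H). *)
Definition compact_operator_on (R : realType) (V W : normedModType R[i])
    (E : set V) (T : V -> W) : Prop :=
  precompact (T @` (E `&` unit_ball)).

Definition compact_element (R : realType) (X : topologicalType)
    (phi : homeomorphism X) (H0 : normedModType R[i]) (dot : hilbert_dot H0)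
    (rho : faithful_rep X dot) (A : bop (ell2 H0)) : Prop :=
  compact_operator_on (semicrossed phi rho)
    (fun T => bop_comp A (bop_comp T A)).

Definition metrizable (R : realType) (X : topologicalType) : Prop :=
  exists d : X -> X -> R,
    [/\ forall x y, 0 <= d x y,
        forall x y, d x y = 0 <-> x = y,
        forall x y, d x y = d y x,
        forall x y z, d x z <= d x y + d y z &
        forall x (U : set X), nbhs x U <->
          exists2 e : R, 0 < e & [set y | d x y < e] `<=` U].

Definition recurrent (X : topologicalType) (phi : X -> X) : set X :=
  [set x | exists2 n : nat -> nat, {homo n : j k / (j < k)%N} &
    (fun k => iter (n k) phi x) @ \oo --> x].

(* Main.v *)
Require Import Defs.
From HB Require Import structures.
From mathcomp Require Import all_boot all_order all_algebra.
From mathcomp Require Import all_classical all_reals all_analysis.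
From mathcomp Require Import complex ring lra.

Set Implicit Arguments.
Unset Strict Implicit.
Unset Printing Implicit Defensive.

Import Order.TTheory GRing.Theory Num.Theory numFieldNormedType.Exports.
Local Open Scope classical_set_scope.
Local Open Scope complex_scope.
Local Open Scope ring_scope.

(** The algebra acts on H0 (x) l^2 by lower triangular matrices: an element T
    with Fourier coefficients t has the entry rho (alpha^k (t (j - k))) in row
    j and column k.  So T is determined by t, products become the convolution
    [cprod], and a bound on the norm of T is a bound on the action of the
    matrix on initial segments of arbitrary sequences ([energy_toeplitz]).  An
    injective representation of C_0(X) is isometric ([rep_isometry]), whence
    |t n| <= |T| and the coefficient maps extend to the closure
    ([coefs_fourier]).

    If A is compact, the elements A (U^l h) A with |h| <= 1 form a precompact
    family, so their Fourier coefficients tend to zero uniformly and are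
    equicontinuous.  The coefficient of index N + l at x is the sum over
    n <= N of f_(N-n)(phi^(n+l) x) h(phi^n x) f_n(x).  At a recurrent x, strong
    induction on m leaves only the middle term for N = 2m, and its decay along
    the return times gives f_m(x)^2 = 0.  At any other x the orbit is injective
    and a bump function h around phi^n x isolates the n-th term; equicontinuity
    is then condition (3), and comparing x with a nearby point where h vanishes
    gives condition (1).

    Conversely, Fejér means ([fejer_cvg]) reduce the problem to the maps T |->
    U^m f T U^n g with f = f_m and g = f_n. The decisive estimate is
    [rnorm_sandwich]: the norm of U^m f T U^n g is at most |T| times the
    supremum of |f(phi^(n+l) x) g(x)| over l and x, although T may have
    infinitely many coefficients. It holds because T is lower triangular and
    commutes with the diagonal action of C_0(X), so that it increases an energy
    with decreasing weights by a factor of at most |T|^2 (an Abel summation).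
    By (1) and (3) the supremum is small once finitely many isolated points x
    are removed from g ([finite_large_points]); by (1), (2) and (3) the
    function f tends to zero along every orbit ([orbit_vanish]), so f too may
    be reduced to finitely many isolated points. When f and g are point masses
    at isolated points and that of f is not periodic, the map has rank at most
    one; at periodic points f vanishes by (2). Hence the image of the unit ball
    is totally bounded, and it is precompact because the bounded operators on
    l^2(H0) are complete. *)

(** * Nets, precompactness and completeness *)

Lemma add3_lt (R : realType) (e a b c : R) :
  a < e / 3 -> b <= e / 3 -> c < e / 3 -> a + (b + c) < e.
Proof. lra. Qed.

Lemma half_lt (R : realType) (a b c : R) : a <= b + c -> b < a / 2 -> a / 2 < c.
Proof. lra. Qed.

Lemma le0_of_small (R : realType) (a C : R) :
  (forall e : R, 0 < e -> a <= e * C) -> a <= 0.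
Proof.
move=> aC; apply/ler_addgt0Pr => e e0; rewrite add0r.
pose c := `|C| + 1; have c0 : 0 < c by rewrite ltr_wpDl.
have := aC (e / c); rewrite divr_gt0// => /(_ isT) /le_trans; apply.
rewrite -mulrA ler_piMr ?(ltW e0)// ler_pdivrMl// mulr1.
by rewrite (le_trans (ler_norm C))// lerDl.
Qed.

Lemma sqr_sum_le (R : realType) N (a : nat -> R) :
  (\sum_(p < N) a p) ^+ 2 <= N%:R * \sum_(p < N) a p ^+ 2.
Proof.
elim: N => [|N IH]; first by rewrite !big_ord0 expr0n mul0r.
rewrite !big_ord_recr/=; case: N IH => [|N] IH.
  by rewrite !big_ord0 !add0r mul1r.
set A := \sum_(_ < _) a _ in IH *; set S := \sum_(_ < _) _ in IH *.
have N0 : 0 < N.+1%:R :> R by rewrite ltr0Sn.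
rewrite -[N.+2]addn1 natrD; set n : R := N.+1%:R in IH N0 *.
have : 0 <= n^-1 * (A - n * a N.+1) ^+ 2 by rewrite mulr_ge0 ?sqr_ge0 ?invr_ge0 ?ltW.
have -> : n^-1 * (A - n * a N.+1) ^+ 2 =
    n^-1 * A ^+ 2 - A * a N.+1 *+ 2 + n * a N.+1 ^+ 2.
  by field; rewrite gt_eqF.
have : n^-1 * A ^+ 2 <= S by rewrite ler_pdivrMl.
move: IH; set u := n^-1 * _; lra.
Qed.

(** If no finite family sufficed, the points of K outside finite unions would
    generate a proper filter, and a cluster point of it would be excluded by its
    own neighbourhood. *)
Lemma compact_finite_nbhs (X : topologicalType) (K : set X) (U : X -> set X) :
  compact K -> (forall x, K x -> nbhs x (U x)) ->
  exists2 s : seq X, forall x, x \in s -> K x &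
    forall y, K y -> exists2 x, x \in s & U x y.
Proof.
move=> cK KU; apply: contrapT => nK.
pose D := [set s : seq X | forall x, x \in s -> K x].
pose B (s : seq X) := K `&` [set y | forall x, x \in s -> ~ U x y].
have FF : Filter (filter_from D B).
  apply: filter_from_filter => [|s t sD tD]; first by exists [::].
  exists (s ++ t) => [x|y [Ky st]]; first by rewrite mem_cat => /orP[/sD|/tD].
  by split; split=> // x xs; apply: st; rewrite mem_cat xs ?orbT.
have FP : ProperFilter (filter_from D B).
  apply: filter_from_proper => // s sD; apply: contrapT => /set0P/negP/negPn/eqP sB.
  apply: nK; exists s => // y Ky; apply: contrapT => ny.
  have : B s y by split=> // x xs Uxy; apply: ny; exists x.
  by rewrite sB.
have [|x [Kx clx]] := cK (filter_from D B) FP.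
  by exists [::] => // y [].
have [|y [[_ yx] Uxy]] := clx (B [:: x]) (U x) _ (KU x Kx).
  by exists [:: x] => // z; rewrite inE => /eqP->.
by apply: (yx x) => //; rewrite inE.
Qed.

Section NormTopology.
Context {R : realType} {V : normedModType R[i]}.
Implicit Types (v w : V) (F : set_system V) (K : set V).

Lemma rnormC v w : rnorm (v - w) = rnorm (w - v).
Proof. by rewrite -rnormN opprB. Qed.

Lemma rnorm_triangle w u v : rnorm (u - v) <= rnorm (u - w) + rnorm (w - v).
Proof. by rewrite -{1}(subrKA w) rnormD. Qed.

Lemma nbhs_rnormP v (U : set V) :
  nbhs v U <-> exists2 e : R, 0 < e & forall w, rnorm (v - w) < e -> U w.
Proof.
rewrite -nbhs_ballE; split=> [[e /= e0 eU]|[e e0 eU]].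
  have eE : e = (complex.Re e)%:C by rewrite RRe_real ?gtr0_real.
  exists (complex.Re e) => [|w vw]; first by rewrite -ltcR -eE.
  by apply: eU; rewrite -ball_normE/= rnormE eE ltcR.
exists e%:C => [/=|w]; first by rewrite ltcR.
by rewrite -ball_normE/= rnormE ltcR; exact: eU.
Qed.

Lemma nbhs_rnorm v (e : R) : 0 < e -> nbhs v [set w | rnorm (v - w) < e].
Proof. by move=> e0; apply/nbhs_rnormP; exists e. Qed.

(** Norms take their values in R[i]; nets and Cauchy filters use real radii. *)
Definition norm_cauchy F :=
  forall e : R, 0 < e -> exists v, F [set w | rnorm (v - w) < e].

End NormTopology.

Definition norm_complete (R : realType) (V : normedModType R[i]) :=
  forall F : set_system V, ProperFilter F -> norm_cauchy F -> exists v : V, F --> v.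

Definition totally_bounded (R : realType) (V : normedModType R[i]) (K : set V) :=
  forall e : R, 0 < e ->
    exists s : seq V, forall v, K v -> exists2 c, c \in s & rnorm (v - c) < e.

Section TotallyBounded.
Context {R : realType} {V : normedModType R[i]}.
Implicit Types (K : set V).

(** The centres lie in K itself and not only in its closure, so that whatever is
    known about the elements of K applies to them. *)
Lemma precompact_net K (e : R) : precompact K -> 0 < e ->
  exists2 s : seq V, forall c, c \in s -> K c &
    forall v, K v -> exists2 c, c \in s & rnorm (v - c) < e.
Proof.
move=> pK e0; have e20 : 0 < e / 2 by rewrite divr_gt0.
rewrite precompactE in pK.
have [|s sK Ks] := compact_finite_nbhs (U := fun c => [set w | rnorm (c - w) < e / 2]) pK.
  by move=> c _; exact: nbhs_rnorm.
have near c : c \in s -> exists w, K w /\ rnorm (c - w) < e / 2.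
  by move=> /sK /(_ _ (nbhs_rnorm c e20))[w [Kw cw]]; exists w.
have [f fP] : exists f : V -> V, forall c, c \in s -> K (f c) /\ rnorm (c - f c) < e / 2.
  exists (fun c => if pselect (c \in s) is left cs then projT1 (cid (near c cs)) else c).
  by move=> c cs; case: pselect => // cs'; exact: (projT2 (cid (near c cs'))).
exists [seq f c | c <- s] => [c /mapP[d /fP[Kd _] ->//]|v Kv].
have [c cs cv] := Ks v (@subset_closure _ K v Kv).
exists (f c); first exact: map_f.
apply: le_lt_trans (rnorm_triangle c _ _) _.
have [_ cf] := fP c cs.
by rewrite (splitr e) ltrD// rnormC.
Qed.

(** An ultrafilter on a set with finite nets contains a ball of every radius,
    hence is Cauchy. *)
Lemma totally_bounded_precompact K :
  norm_complete V -> totally_bounded K -> precompact K.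
Proof.
move=> cV tK; rewrite precompactE compact_ultra => F UF FK.
have [|v Fv] := cV F _.
  move=> e e0; have e20 : 0 < e / 2 by rewrite divr_gt0.
  have [s sK] := tK _ e20.
  have : F (\bigcup_(c in [set` s]) [set w | rnorm (c - w) < e]).
    apply: filterS FK => v /(_ _ (nbhs_rnorm v e20))[w [/sK[c cs wc] vw]].
    exists c => //=; apply: le_lt_trans (rnorm_triangle w _ _) _.
    by rewrite (splitr e) ltrD// rnormC.
  elim: s {sK} => [|c s IH] Fs.
    by have [v [c]] := filter_ex Fs.
  have [Fc|Fc] := in_ultra_setVsetC [set w | rnorm (c - w) < e] UF; first by exists c.
  apply: IH; apply: filterS (filterI Fs Fc) => v [[d]].
  by rewrite /= inE => /orP[/eqP->//|ds] dv _; exists d.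
exists v; split; last exact: Fv.
apply: closed_closure => U /Fv FU; exact: (filter_ex (filterI FK FU)).
Qed.

End TotallyBounded.

Lemma complete_norm_complete (R : realType) (V : completeNormedModType R[i]) :
  norm_complete V.
Proof.
move=> F FF cF; exists (lim F); apply: cauchy_cvg; apply: cauchy_exP => e e0.
have eE : e = (complex.Re e)%:C by rewrite RRe_real ?gtr0_real.
have [|v Fv] := cF (complex.Re e); first by rewrite -ltcR -eE.
by exists v; apply: filterS Fv => w; rewrite -ball_normE/= rnormE eE ltcR.
Qed.

Section ComplexNorm.
Context {R : realType}.
Implicit Types z w : R[i]^o.

Lemma rnormcE z : rnorm z = Num.sqrt (complex.Re z ^+ 2 + complex.Im z ^+ 2).
Proof. by case: z. Qed.

Lemma rnorm_Re z : `|complex.Re z| <= rnorm z.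
Proof. by rewrite rnormcE -sqrtr_sqr ler_wsqrtr// lerDl sqr_ge0. Qed.

Lemma rnorm_Im z : `|complex.Im z| <= rnorm z.
Proof. by rewrite rnormcE -sqrtr_sqr ler_wsqrtr// lerDr sqr_ge0. Qed.

Let ReB z w : complex.Re (z - w) = complex.Re z - complex.Re w.
Proof. by case: z w => [? ?] [? ?]. Qed.

Let ImB z w : complex.Im (z - w) = complex.Im z - complex.Im w.
Proof. by case: z w => [? ?] [? ?]. Qed.

Lemma rnorm_le_ReIm z : rnorm z <= `|complex.Re z| + `|complex.Im z|.
Proof.
rewrite rnormcE -[leRHS]ger0_norm ?addr_ge0// -sqrtr_sqr ler_wsqrtr//.
rewrite sqrrD -!(normrX 2) !(ger0_norm (sqr_ge0 _)) addrAC lerDl.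
by rewrite mulrn_wge0// mulr_ge0.
Qed.

Lemma complex_norm_complete : norm_complete (R[i]^o : normedModType R[i]).
Proof.
have real_cauchy (F : set_system R^o) : ProperFilter F ->
    (forall e : R, 0 < e -> exists x, F [set y | `|x - y| < e]) -> exists x : R^o, F --> x.
  move=> FF cF; exists (lim F); apply: cauchy_cvg; apply: cauchy_exP => e e0.
  have [x Fx] := cF e e0.
  by exists x; apply: filterS Fx => y; rewrite -ball_normE.
move=> F FF cF.
have [|a Fa] := real_cauchy (@complex.Re R @ F).
  move=> e /cF[z Fz]; exists (complex.Re z).
  change (F [set w | `|complex.Re z - complex.Re w| < e]).
  apply: filterS Fz => w; apply: le_lt_trans; rewrite -ReB; exact: rnorm_Re.
have [|b Fb] := real_cauchy (@complex.Im R @ F).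
  move=> e /cF[z Fz]; exists (complex.Im z).
  change (F [set w | `|complex.Im z - complex.Im w| < e]).
  apply: filterS Fz => w; apply: le_lt_trans; rewrite -ImB; exact: rnorm_Im.
exists (a +i* b) => U /nbhs_rnormP[e e0 eU].
have e20 : 0 < e / 2 by rewrite divr_gt0.
have Fa' : F [set w | `|a - complex.Re w| < e / 2].
  apply: (Fa [set x | `|a - x| < e / 2]).
  by apply/(@nbhs_ballP _ R^o); exists (e / 2) => // y; rewrite -ball_normE.
have Fb' : F [set w | `|b - complex.Im w| < e / 2].
  apply: (Fb [set x | `|b - x| < e / 2]).
  by apply/(@nbhs_ballP _ R^o); exists (e / 2) => // y; rewrite -ball_normE.
apply: filterS (filterI Fa' Fb') => -[x y]/= [ax bY]; apply: eU.
apply: le_lt_trans (rnorm_le_ReIm _) _ => /=.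
by rewrite (splitr e) ltrD.
Qed.

End ComplexNorm.

(** * Continuous functions vanishing at infinity *)

Section C0Constructions.
Context {R : realType} {X : topologicalType}.
Implicit Types (f g : C0 R X).

Lemma continuous_rnormP (g : X -> R[i]^o) : continuous g <->
  forall x (e : R), 0 < e -> nbhs x [set y | rnorm (g x - g y) < e].
Proof.
split=> [cg x e e0|cg x U /nbhs_rnormP[e e0 eU]].
  exact: (cg x _ (nbhs_rnorm (g x : R[i]^o) e0)).
by apply: filterS (cg x e e0) => y /eU.
Qed.

Lemma C0_near f x (e : R) : 0 < e -> nbhs x [set y | rnorm (f x - f y) < e].
Proof.
by have /C0_predP[/continuous_rnormP cf _] := C0_valP f; exact: cf.
Qed.

Lemma C0_vanish f (e : R) : 0 < e ->
  exists2 K : set X, compact K & forall x, ~ K x -> rnorm (f x) < e.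
Proof. by have /C0_predP[_] := C0_valP f; exact. Qed.

Lemma C0_dominated (g : X -> R[i]^o) f (M : R) : continuous g ->
  (forall x, rnorm (g x) <= M * rnorm (f x)) -> g \in C0_pred.
Proof.
move=> cg gf; apply/C0_predP; split=> // e e0.
pose c := `|M| + 1; have c0 : 0 < c by rewrite ltr_wpDl.
have [|K cK fK] := C0_vanish f (e := e / c); first by rewrite divr_gt0.
exists K => // x /fK fx; apply: le_lt_trans (gf x) _.
apply: le_lt_trans (_ : _ <= c * rnorm (f x)) _.
  by rewrite ler_wpM2r ?rnorm_ge0// (le_trans (ler_norm _))// lerDl.
by rewrite -ltr_pdivlMl// mulrC.
Qed.

Lemma continuous_real_complex (r : X -> R^o) :
  continuous r -> continuous (fun x => (r x)%:C : R[i]^o).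
Proof.
move=> cr; apply/continuous_rnormP => x e e0.
have /(@cvgrPdist_lt _ R^o) /(_ e e0) := cr x.
by apply: filterS => y; rewrite /= -rmorphB rnorm_real.
Qed.

Lemma C0_rnorm_continuous f : continuous (fun x => rnorm (f x) : R^o).
Proof.
move=> x; have /C0_predP[cf _] := C0_valP f.
exact: continuous_comp (cf x) (@rnorm_continuous _ _ _).
Qed.

(** The pointwise limit of a Cauchy filter is a uniform limit, and uniform
    limits inherit continuity and decay. *)
Lemma C0_complete : norm_complete (C0 R X).
Proof.
move=> F FF cF.
have lx x : exists z : R[i]^o, (fun f : C0 R X => f x) @ F --> z.
  apply: complex_norm_complete => e /cF[f Ff]; exists (f x).
  change (F [set g : C0 R X | rnorm (f x - g x) < e]).
  by apply: filterS Ff => g; apply: le_lt_trans; exact: (rnorm_C0 (f - g)).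
pose l x := projT1 (cid (lx x)).
have lP x (d : R) : 0 < d -> F [set g : C0 R X | rnorm (l x - g x) < d].
  move=> d0; have := projT2 (cid (lx x)); rewrite -/(l x).
  by move=> /(_ _ (nbhs_rnorm (l x : R[i]^o) d0)).
have unif (e : R) : 0 < e ->
    F [set g : C0 R X | forall x, rnorm (l x - g x) <= e].
  move=> e0; have e20 : 0 < e / 2 by rewrite divr_gt0.
  have [f Ff] := cF _ e20; apply: filterS (Ff) => g fg x.
  apply/ler_addgt0Pr => d d0.
  have [h [fh lh]] := filter_ex (filterI Ff (lP x d d0)).
  have hg : rnorm (h - g) <= e.
    apply: le_trans (rnorm_triangle f _ _) _.
    by rewrite (splitr e) lerD//; apply: ltW => //; rewrite rnormC.
  apply: le_trans (rnorm_triangle (h x) _ _) _.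
  rewrite addrC lerD//; last exact: ltW.
  exact: le_trans (rnorm_C0 (h - g) x) hg.
have lC0 : l \in C0_pred.
  apply/C0_predP; split=> [|e e0].
    apply/continuous_rnormP => x e e0; have e30 : 0 < e / 3 by rewrite divr_gt0.
    have [g lg] := filter_ex (unif _ e30).
    apply: filterS (C0_near g x e30) => y /= gxy.
    apply: le_lt_trans (rnorm_triangle (g x) _ _) _.
    apply: le_lt_trans (lerD (lexx _) (rnorm_triangle (g y) _ _)) _.
    have := lg x; have := lg y; rewrite (rnormC (l y)); move: gxy; lra.
  have e20 : 0 < e / 2 by rewrite divr_gt0.
  have [g lg] := filter_ex (unif _ e20).
  have [K cK gK] := C0_vanish g e20; exists K => // x /gK gx.
  rewrite -(subrK (g x) (l x)); apply: le_lt_trans (rnormD _ _) _.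
  by rewrite (splitr e) ler_ltD.
exists (MkC0 lC0) => U /nbhs_rnormP[e e0 eU].
have e20 : 0 < e / 2 by rewrite divr_gt0.
apply: filterS (unif _ e20) => g lg; apply: eU.
apply: le_lt_trans (_ : _ <= e / 2) _.
  rewrite rnorm_C0E; apply: supnorm_le => [|x _]; [exact: ltW|exact: lg].
by rewrite ltr_pdivrMr// mulr_natr mulr2n ltrDl.
Qed.

End C0Constructions.

(** * Faithful representations *)

Section SquareRoots.
Context {R : realType} {X : topologicalType}.
Implicit Types (f g : C0 R X).

Lemma C0_sqrt (u : X -> R^o) g : continuous u ->
  (forall x, 0 <= u x <= rnorm (g x) ^+ 2) ->
  exists c : C0 R X, forall x, c x = (Num.sqrt (u x))%:C.
Proof.
move=> cu ug.
have cP : (fun x => (Num.sqrt (u x))%:C : R[i]^o) \in C0_pred.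
  apply: (@C0_dominated _ _ _ g 1) => [|x].
    apply: continuous_real_complex => x.
    exact: (continuous_comp (cu x) (@sqrt_continuous _ _)).
  rewrite rnorm_real ger0_norm ?sqrtr_ge0// mul1r.
  have /andP[_ ux] := ug x.
  by rewrite -(ger0_norm (rnorm_ge0 (g x))) -sqrtr_sqr ler_wsqrtr.
by exists (MkC0 cP).
Qed.

Lemma C0_rnorm2_continuous f : continuous (fun x => rnorm (f x) ^+ 2 : R^o).
Proof.
move=> x; under eq_fun do rewrite expr2.
by apply: cvgM; exact: C0_rnorm_continuous.
Qed.

Lemma C0_abs f : exists a : C0 R X, forall x, a x = (rnorm (f x))%:C.
Proof.
have aP : (fun x => (rnorm (f x))%:C : R[i]^o) \in C0_pred.
  apply: (@C0_dominated _ _ _ f 1) => [|x].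
    exact/continuous_real_complex/C0_rnorm_continuous.
  by rewrite rnorm_real ger0_norm ?rnorm_ge0// mul1r.
by exists (MkC0 aP).
Qed.

Lemma C0_sub_sqr f g : (forall x, rnorm (f x) ^+ 2 <= rnorm (g x) ^+ 2) ->
  exists c : C0 R X, forall x,
    rnorm (c x) ^+ 2 = rnorm (g x) ^+ 2 - rnorm (f x) ^+ 2.
Proof.
move=> fg.
have [|x|c cE] := @C0_sqrt (fun x => rnorm (g x) ^+ 2 - rnorm (f x) ^+ 2) g.
- by move=> x; apply: (@cvgB _ R^o); exact: C0_rnorm2_continuous.
- by rewrite subr_ge0 fg/= lerBlDr lerDl sqr_ge0.
exists c => x; rewrite cE rnorm_real ger0_norm ?sqrtr_ge0// sqr_sqrtr//.
by rewrite subr_ge0.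
Qed.

Lemma C0_sum_sqr (b : nat -> C0 R X) (r : seq nat) :
  exists c : C0 R X, forall x,
    rnorm (c x) ^+ 2 = \sum_(k <- r) rnorm (b k x) ^+ 2.
Proof.
elim: r => [|k r [c cE]].
  by exists 0 => x; rewrite big_nil rnorm0 expr0n.
have [a aE] := C0_abs c; have [d dE] := C0_abs (b k).
have [|x|e eE] := @C0_sqrt (fun x => rnorm (b k x) ^+ 2 + rnorm (c x) ^+ 2) (d + a).
- by move=> x; apply: (@cvgD _ R^o); exact: C0_rnorm2_continuous.
- have -> : (d + a) x = (rnorm (b k x) + rnorm (c x))%:C.
    by rewrite rmorphD/= -aE -dE.
  rewrite addr_ge0 ?sqr_ge0//= rnorm_real ger0_norm ?addr_ge0 ?rnorm_ge0//.
  by rewrite sqrrD addrAC lerDl mulrn_wge0// mulr_ge0// rnorm_ge0.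
exists e => x; rewrite eE rnorm_real ger0_norm ?sqrtr_ge0// sqr_sqrtr.
  by rewrite big_cons cE.
by rewrite addr_ge0// sqr_ge0.
Qed.

End SquareRoots.

Section FaithfulRepresentation.
Context {R : realType} {X : topologicalType} {H0 : normedModType R[i]}.
Context {dot : hilbert_dot H0} (rho : faithful_rep X dot).
Implicit Types (f g : C0 R X) (v : H0).

Lemma rnorm_rep_le f v : rnorm (rho f v) <= rnorm f * rnorm v.
Proof.
apply: le_trans (rnorm_bop _ _) _; rewrite ler_wpM2r ?rnorm_ge0//.
exact: rep_contractive.
Qed.

Lemma rep_mulE f g v : rho (C0_mul f g) v = rho f (rho g v).
Proof. by rewrite rep_mul. Qed.

Lemma C0_mulC f g : C0_mul f g = C0_mul g f.
Proof. by apply/val_inj/funext => x; rewrite /= mulrC. Qed.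

Lemma rep_comm f g v : rho f (rho g v) = rho g (rho f v).
Proof. by rewrite -!rep_mulE C0_mulC. Qed.

(** If |rho f| < d < |f|, let h = max(|f|, d) - d, which is not zero, and
    w = conj f / max(|f|, d)^2.  Then w f h = h, as w f = 1 where h is not
    zero, and |w| <= 1 / d.  So rho h = rho w (rho f (rho h)) has norm
    at most (|rho f| / d) |rho h| with |rho f| / d < 1, and rho h = 0,
    against injectivity. *)
Lemma rep_isometry f : rnorm (rho f) = rnorm f.
Proof.
apply/eqP; rewrite eq_le rep_contractive/= leNgt; apply/negP => cf.
pose c := rnorm (rho f); pose d := (c + rnorm f) / 2.
have c0 : 0 <= c := rnorm_ge0 _.
have [cd df] : c < d /\ d < rnorm f.
  by rewrite /d; move: cf; rewrite -/c => cf; split; lra.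
have d0 : 0 < d := le_lt_trans c0 cd.
have cm (a : R) : continuous (fun x => Num.max (rnorm (f x)) a : R^o).
  by move=> x; apply: (@continuous_max _ _ _ _ x) => //;
    [exact: C0_rnorm_continuous|exact: cvg_cst].
have hP : (fun x => (Num.max (rnorm (f x)) d - d)%:C : R[i]^o) \in C0_pred.
  apply: (@C0_dominated _ _ _ f 1) => [|x].
    apply: continuous_real_complex => x.
    by apply: (@cvgB _ R^o); [exact: cm|exact: cvg_cst].
  rewrite rnorm_real mul1r ger0_norm ?subr_ge0 ?le_max ?lexx ?orbT//.
  by rewrite lerBlDr ge_max lerDl ltW//= lerDr rnorm_ge0.
have mp x : 0 < Num.max (rnorm (f x)) d by rewrite lt_max d0 orbT.
have cV : continuous (fun x => Num.max (rnorm (f x)) d ^- 2 : R^o).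
  move=> x; apply: (@cvgV R X (nbhs x) _ (fun x => Num.max (rnorm (f x)) d ^+ 2)).
    by rewrite expf_neq0// gt_eqF.
  under eq_fun do rewrite expr2.
  by apply: cvgM; exact: cm.
have wn x : rnorm ((Num.max (rnorm (f x)) d ^- 2)%:C * Num.conj (f x) : R[i]^o) =
    Num.max (rnorm (f x)) d ^- 2 * rnorm (f x).
  rewrite rnormM rnorm_real ger0_norm ?invr_ge0 ?sqr_ge0//; congr (_ * _).
  by apply: complexI; rewrite -!rnormE norm_conjC.
have wP : (fun x => (Num.max (rnorm (f x)) d ^- 2)%:C * Num.conj (f x) : R[i]^o)
    \in C0_pred.
  apply: (@C0_dominated _ _ _ f (d ^- 2)) => [|x].
    have /C0_predP[ccf _] := C0_valP (C0_conj f).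
    move=> x; have ct := continuous_real_complex cV (x := x).
    exact: (cvgM ct (ccf x)).
  rewrite wn ler_wpM2r ?rnorm_ge0// lef_pV2 ?posrE ?exprn_gt0//.
  by rewrite ler_sqr ?nnegrE ?(ltW d0) ?(ltW (mp x))// le_max lexx orbT.
pose h := MkC0 hP; pose w := MkC0 wP.
have nw : rnorm w <= d^-1.
  rewrite rnorm_C0E; apply: supnorm_le => [|x _]; first by rewrite invr_ge0 ltW.
  rewrite wn expr2 invfM -mulrA ler_pdivrMl//.
  apply: (@le_trans _ _ 1); last by rewrite ler_pdivlMr// mul1r le_max lexx orbT.
  by rewrite ler_pdivrMl// mulr1 le_max lexx.
have wfh : C0_mul w (C0_mul f h) = h.
  apply/val_inj/funext => x /=; have [fd|fd] := leP (rnorm (f x)) d.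
    by rewrite subrr !mulr0.
  have f0 : (rnorm (f x))%:C != 0 :> R[i].
    by rewrite eq_complex/= negb_and gt_eqF// (lt_trans d0).
  rewrite mulrA -(mulrA _ (Num.conj _)) (mulrC (Num.conj _)) -normCK.
  by rewrite rnormE fmorphV/= rmorphXn/= mulVf ?mul1r// expf_neq0.
have rh0 : rho h = 0.
  apply/val_inj/funext => v; apply/rnorm0_eq0/eqP.
  rewrite eq_le rnorm_ge0 andbT leNgt; apply/negP => hp.
  suff : rnorm (rho h v) < rnorm (rho h v) by rewrite ltxx.
  rewrite -{1}wfh !rep_mulE.
  apply: le_lt_trans (rnorm_rep_le _ _) _.
  apply: le_lt_trans (ler_wpM2r (rnorm_ge0 _) nw) _.
  rewrite ltr_pdivrMl//; apply: le_lt_trans (rnorm_bop _ _) _.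
  by rewrite ltr_pM2r.
have h0 : h = 0 by apply: (@rep_inj _ _ _ _ rho); rewrite rh0 linear0.
have : rnorm f <= d.
  rewrite rnorm_C0E; apply: supnorm_le => [|x _]; first exact: ltW.
  have : h x = 0 by rewrite h0.
  move=> /complexI /eqP; rewrite subr_eq0 => /eqP <-.
  by rewrite le_max lexx.
by rewrite leNgt df.
Qed.

(** The squared norm of rho f v is the value at |f|^2 of the linear form
    u |-> <v, rho u v>. *)
Lemma rep_pythagoras (b : nat -> C0 R X) (r : seq nat) f v :
  (forall x, rnorm (f x) ^+ 2 = \sum_(k <- r) rnorm (b k x) ^+ 2) ->
  rnorm (rho f v) ^+ 2 = \sum_(k <- r) rnorm (rho (b k) v) ^+ 2.
Proof.
move=> fb; pose m g := C0_mul (C0_conj g) g.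
have dotE g : (rnorm (rho g v) ^+ 2)%:C = dot v (rho (m g) v).
  by rewrite rmorphXn/= -rnormE -(hdotE dot) rep_adj rep_mulE.
have mf : m f = \sum_(k <- r) m (b k).
  apply/val_inj/funext => x.
  have -> : val (\sum_(k <- r) m (b k)) x = \sum_(k <- r) m (b k) x.
    by elim/big_ind2 : _ => // a b1 c d <- <-.
  have mE g : m g x = (rnorm (g x) ^+ 2)%:C.
    by rewrite /m/= mulrC -normCK rnormE rmorphXn.
  by rewrite [LHS]mE fb rmorph_sum; apply: eq_bigr => k _; rewrite mE.
apply: complexI; rewrite dotE mf rmorph_sum/=.
rewrite (eq_bigr _ (fun k _ => dotE (b k))).
elim: r {fb mf} => [|k r IH]; first by rewrite !big_nil linear0 linear0r.
by rewrite !big_cons -IH linearD/= linearDr.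
Qed.

(** The missing part |f|^2 <= sum of |b_k|^2 is made up by one more square of a
    function of C_0(X), so the form of [rep_pythagoras] is monotone. *)
Lemma rep_dominated (b : nat -> C0 R X) (r : seq nat) f v :
  (forall x, rnorm (f x) ^+ 2 <= \sum_(k <- r) rnorm (b k x) ^+ 2) ->
  rnorm (rho f v) ^+ 2 <= \sum_(k <- r) rnorm (rho (b k) v) ^+ 2.
Proof.
move=> fb; have [c cE] := C0_sum_sqr b r.
have [|d dE] := @C0_sub_sqr _ _ f c; first by move=> x; rewrite cE.
rewrite -(rep_pythagoras _ cE).
rewrite (@rep_pythagoras (fun k => if k is 0%N then f else d) [:: 0%N; 1%N] c).
  by rewrite !big_cons big_nil/= addr0 lerDl sqr_ge0.
by move=> x; rewrite !big_cons big_nil/= addr0 dE; ring.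
Qed.

End FaithfulRepresentation.

(** * Fourier coefficients as matrices *)

Lemma sum_triangle (V : nmodType) (G : nat -> nat -> V) J :
  \sum_(m < J.+1) \sum_(n < (J - m).+1) G m n =
  \sum_(k < J.+1) \sum_(n < k.+1) G (k - n)%N n.
Proof.
elim: J => [|J IH]; first by rewrite !big_ord1.
rewrite big_ord_recr/= [RHS]big_ord_recr/= -IH.
have -> : \sum_(n < (J.+1 - J.+1).+1) G J.+1 n = G J.+1 0%N.
  by rewrite subnn big_ord1.
have -> : \sum_(m < J.+1) \sum_(n < (J.+1 - m).+1) G m n =
    \sum_(m < J.+1) \sum_(n < (J - m).+1) G m n +
    \sum_(m < J.+1) G m (J.+1 - m)%N.
  rewrite -big_split/=; apply: eq_bigr => m _.
  by rewrite subSn ?big_ord_recr// -ltnS.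
rewrite -addrA; congr (_ + _).
have -> : \sum_(m < J.+1) G m (J.+1 - m)%N + G J.+1 0%N =
    \sum_(m < J.+2) G m (J.+1 - m)%N.
  by rewrite [RHS]big_ord_recr/= subnn.
rewrite (reindex_inj rev_ord_inj)/=; apply: eq_bigr => n _.
by rewrite subSS subKn// -ltnS.
Qed.

Section Toeplitz.
Context {R : realType} {X : topologicalType} (phi : homeomorphism X).
Context {H0 : normedModType R[i]} {dot : hilbert_dot H0}.
Context (rho : faithful_rep X dot).
Implicit Types (f g : C0 R X) (s t : nat -> C0 R X) (xi eta : nat -> H0).
Implicit Types (S T : bop (ell2 H0)).

Notation al k f := (iter k (alpha phi) f).

Lemma alphaP k a f g : al k (a *: f + g) = a *: al k f + al k g.
Proof.
apply/val_inj/funext => x.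
rewrite [LHS]iter_alphaE; transitivity (a * al k f x + al k g x) => //.
by rewrite !iter_alphaE.
Qed.

Lemma alpha0 k : al k (0 : C0 R X) = 0.
Proof. by apply/val_inj/funext => x; rewrite [LHS]iter_alphaE. Qed.

Lemma alphaM k f g : al k (C0_mul f g) = C0_mul (al k f) (al k g).
Proof. by apply/val_inj/funext => x /=; rewrite !iter_alphaE. Qed.

Lemma alpha_sum k n (F : 'I_n -> C0 R X) : al k (\sum_(i < n) F i) = \sum_(i < n) al k (F i).
Proof.
elim/big_ind2 : _ => // [|f1 f2 g1 g2 <- <-]; first exact: alpha0.
by have := alphaP k 1 f2 g2; rewrite !scale1r.
Qed.

Lemma C0_sumE n (F : 'I_n -> C0 R X) x : (\sum_(i < n) F i) x = \sum_(i < n) F i x.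
Proof. by elim/big_ind2 : _ => // f a g b <- <-. Qed.

(** The action on arbitrary sequences of the lower triangular operator matrix
    whose entry in row j and column k is rho (alpha^k (t (j - k))). *)
Definition toeplitz t eta j : H0 :=
  \sum_(n < j.+1) rho (al (j - n) (t n)) (eta (j - n)%N).

Definition coefs T t := forall (xi : ell2 H0) j, T xi j = toeplitz t xi j.

Definition energy J eta : R := \sum_(0 <= k < J) rnorm (eta k) ^+ 2.

Lemma eq_toeplitz t eta eta' j : (forall k, (k <= j)%N -> eta k = eta' k) ->
  toeplitz t eta j = toeplitz t eta' j.
Proof. by move=> e; apply: eq_bigr => n _; rewrite e// leq_subr. Qed.

(** C_0(X) is commutative, so its diagonal action commutes with every matrix
    entry. *)
Lemma toeplitz_rep t c eta j :
  toeplitz t (fun k => rho c (eta k)) j = rho c (toeplitz t eta j).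
Proof. by rewrite linear_sum; apply: eq_bigr => n _; rewrite rep_comm. Qed.

Lemma toeplitzP a s t eta j :
  toeplitz (fun k => a *: s k + t k) eta j = a *: toeplitz s eta j + toeplitz t eta j.
Proof.
rewrite scaler_sumr -big_split; apply: eq_bigr => n _.
by rewrite alphaP linearP.
Qed.

Definition cprod s t (k : nat) : C0 R X :=
  \sum_(n < k.+1) C0_mul (al n (s (k - n)%N)) (t n).

Lemma cprodE s t k x :
  cprod s t k x = \sum_(n < k.+1) s (k - n)%N (iter n phi x) * t n x.
Proof.
by rewrite /cprod C0_sumE; apply: eq_bigr => n _ /=; rewrite iter_alphaE.
Qed.

(** Reading U^m f U^n g = U^(m+n) (alpha^n(f) g) entry by entry. *)
Lemma toeplitz_cprod s t eta j :
  toeplitz (cprod s t) eta j = toeplitz s (toeplitz t eta) j.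
Proof.
pose G m n := rho (al (j - m) (s m)) (rho (al (j - m - n) (t n)) (eta (j - m - n)%N)).
transitivity (\sum_(k < j.+1) \sum_(n < k.+1) G (k - n)%N n).
  apply: eq_bigr => k _; rewrite alpha_sum linear_sum.
  have -> (F : 'I_k.+1 -> bop H0) v : (\sum_i F i) v = \sum_i F i v.
    by elim/big_ind2 : _ => // f a g b <- <-.
  apply: eq_bigr => n _; rewrite alphaM rep_mulE -iterD /G.
  have nk : (n <= k)%N by rewrite -ltnS.
  have kj : (k <= j)%N by rewrite -ltnS.
  by rewrite -subnDA subnK// subnBA// -addnBAC.
rewrite -sum_triangle; apply: eq_bigr => m _; rewrite linear_sum.
by apply: eq_bigr => n _.
Qed.

Lemma coefs_comp S T s t : coefs S s -> coefs T t -> coefs (bop_comp S T) (cprod s t).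
Proof.
move=> sS tT xi j; rewrite toeplitz_cprod [LHS]sS.
by apply: eq_toeplitz => k _; exact: tT.
Qed.

Lemma coefsP a S T s t : coefs S s -> coefs T t ->
  coefs (a *: S + T) (fun k => a *: s k + t k).
Proof. by move=> sS tT xi j; rewrite toeplitzP -sS -tT. Qed.

Lemma coefsB S T s t : coefs S s -> coefs T t -> coefs (S - T) (fun k => s k - t k).
Proof.
move=> sS tT; have := coefsP (-1) tT sS.
by under eq_fun do rewrite scaleN1r addrC; rewrite scaleN1r addrC.
Qed.

Lemma coefs0 : coefs 0 (fun=> 0).
Proof.
move=> xi j; rewrite /toeplitz big1// => n _.
by rewrite alpha0 linear0.
Qed.

Lemma coefs_sum n (F : 'I_n -> bop (ell2 H0)) (t : 'I_n -> nat -> C0 R X) :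
  (forall i, coefs (F i) (t i)) ->
  coefs (\sum_(i < n) F i) (fun k => \sum_(i < n) t i k).
Proof.
move=> Ft; elim: n F t Ft => [|n IH] F t Ft.
  rewrite big_ord0 (_ : (fun k => _) = fun=> 0); first exact: coefs0.
  by apply/funext => k; rewrite big_ord0.
rewrite big_ord_recl (_ : (fun k => _) =
  fun k => 1 *: t ord0 k + \sum_(i < n) t (lift ord0 i) k); last first.
  by apply/funext => k; rewrite big_ord_recl scale1r.
rewrite -[F ord0]scale1r; apply: coefsP; first exact: Ft.
by apply: IH => i; exact: Ft.
Qed.

Lemma eq_coefs T s t : s =1 t -> coefs T s -> coefs T t.
Proof. by move=> /funext ->. Qed.

Lemma coefs_pi (B : ell1 R X) : coefs (pi_rep phi rho B) B.
Proof. by []. Qed.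

Lemma energy_ge0 J eta : 0 <= energy J eta.
Proof. by apply: sumr_ge0 => k _; exact: sqr_ge0. Qed.

Lemma energy_ell2 J (xi : ell2 H0) : energy J xi <= rnorm xi ^+ 2.
Proof.
rewrite -(sqr_sqrtr (energy_ge0 J xi)) ler_sqr ?nnegrE ?sqrtr_ge0 ?rnorm_ge0//.
exact: l2norm_ge (ell2_valP xi).
Qed.

Lemma energy_le eta (M : R) : 0 <= M -> (forall J, energy J eta <= M ^+ 2) ->
  eta \in sq_summable /\ l2norm eta <= M.
Proof.
move=> M0 eM; apply: l2norm_le => J.
rewrite -(ger0_norm M0) -sqrtr_sqr; apply: ler_wsqrtr; exact: eM.
Qed.

Lemma energy_mono J J' eta : (J <= J')%N -> energy J eta <= energy J' eta.
Proof.
move=> JJ; rewrite /energy [leRHS](big_cat_nat (n := J))//= lerDl.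
by apply: sumr_ge0 => k _; exact: sqr_ge0.
Qed.

(** Lower triangularity makes a norm bound hold for initial segments of
    arbitrary sequences: the first J coordinates of the image depend only on
    the first J coordinates of the argument. *)
Lemma energy_toeplitz T t eta J : coefs T t ->
  energy J (toeplitz t eta) <= rnorm T ^+ 2 * energy J eta.
Proof.
move=> tT; pose tr k := if (k < J)%N then eta k else 0.
have trJ K : energy K tr <= energy J eta.
  have eJ : energy J tr = energy J eta.
    by apply: eq_big_nat => k /andP[_ kJ]; rewrite /tr kJ.
  have [KJ|/ltnW JK] := leqP K J; first by rewrite -eJ energy_mono.
  rewrite {1}/energy (big_cat_nat (n := J))//= [X in _ + X]big_nat [X in _ + X]big1 ?addr0.
    by rewrite -eJ.
  by move=> k /andP[Jk _]; rewrite /tr ltnNge Jk rnorm0 expr0n.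
have [|trS trN] := @energy_le tr (Num.sqrt (energy J eta)) (sqrtr_ge0 _).
  by move=> K; rewrite sqr_sqrtr ?energy_ge0.
have -> : energy J (toeplitz t eta) = energy J (T (Ell2 trS)).
  apply: eq_big_nat => k /andP[_ kJ]; rewrite tT.
  congr (rnorm _ ^+ 2); apply: eq_toeplitz => l lk /=.
  by rewrite /tr (leq_ltn_trans lk kJ).
apply: le_trans (energy_ell2 _ _) _.
rewrite -(sqr_sqrtr (energy_ge0 J eta)) -exprMn.
rewrite ler_sqr ?nnegrE ?mulr_ge0 ?rnorm_ge0 ?sqrtr_ge0//.
by apply: le_trans (rnorm_bop _ _) _; rewrite ler_wpM2l ?rnorm_ge0.
Qed.

Lemma rnorm_coefs_le T t (M : R) : coefs T t -> 0 <= M ->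
  (forall (xi : ell2 H0) J, energy J (toeplitz t xi) <= M ^+ 2 * rnorm xi ^+ 2) ->
  rnorm T <= M.
Proof.
move=> tT M0 tM; apply: rnorm_bop_le => // xi.
apply: (energy_le _ _).2 => [|J]; first by rewrite mulr_ge0 ?rnorm_ge0.
rewrite exprMn; apply: le_trans (tM xi J).
by rewrite le_eqVlt; apply/orP; left; apply/eqP/eq_bigr => k _; rewrite tT.
Qed.

(** The first column of the matrix is (rho (t n))_n. *)
Lemma coefs_norm T t n : coefs T t -> rnorm (t n) <= rnorm T.
Proof.
move=> tT; rewrite -(rep_isometry rho).
apply: rnorm_bop_le => [|v]; first exact: rnorm_ge0.
pose eta k := if k is 0%N then v else 0.
have e1 J : energy J.+1 eta = rnorm v ^+ 2.
  rewrite /energy big_nat_recl//= big1 ?addr0// => k _.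
  by rewrite /eta rnorm0 expr0n.
have -> : rho (t n) v = toeplitz t eta n.
  rewrite /toeplitz big_ord_recr/= subnn big1 ?add0r// => k _.
  by rewrite /eta; case: (n - k)%N (subn_gt0 k n) => [|p _];
    rewrite ?ltn_ord// linear0.
rewrite -ler_sqr ?nnegrE ?mulr_ge0 ?rnorm_ge0// exprMn -(e1 n).
apply: le_trans (energy_toeplitz eta n.+1 tT).
by rewrite /energy big_nat_recr//= lerDr energy_ge0.
Qed.

Lemma coefs_unique T s t : coefs T s -> coefs T t -> s = t.
Proof.
move=> sT tT; apply/funext => n; apply/eqP; rewrite -subr_eq0.
apply/eqP/rnorm0_eq0/eqP; rewrite eq_le rnorm_ge0 andbT.
by have := coefs_norm n (coefsB sT tT); rewrite subrr rnorm0.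
Qed.

Lemma coefs_inj S T t : coefs S t -> coefs T t -> S = T.
Proof.
by move=> tS tT; apply/val_inj/funext => xi; apply/val_inj/funext => j; rewrite /= tS tT.
Qed.

Lemma ell1_bound t (M : R) :
  (forall N, \sum_(0 <= n < N) rnorm (t n) <= M) ->
  cvgn (series (fun n => rnorm (t n))) /\ limn (series (fun n => rnorm (t n))) <= M.
Proof.
move=> tM; have c : cvgn (series (fun n => rnorm (t n))).
  apply: nondecreasing_is_cvgn.
    by apply/nondecreasing_series => n _ _; exact: rnorm_ge0.
  by exists M => _ [N _ <-]; exact: tM.
by split=> //; apply: limr_le => //; apply: nearW => N; exact: tM.
Qed.

Lemma rnorm_pi_le (B : ell1 R X) (M : R) :
  (forall N, \sum_(0 <= n < N) rnorm (B n) <= M) -> rnorm (pi_rep phi rho B) <= M.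
Proof.
move=> BM; have [_ lM] := ell1_bound BM.
have M0 : 0 <= M by have := BM 0%N; rewrite big_geq.
apply: rnorm_bop_le => // xi.
apply: le_trans (l2norm_le (pi_fun_sqsum phi rho B xi)).2 _.
by rewrite ler_wpM2r ?rnorm_ge0.
Qed.

Definition delta n f (k : nat) : C0 R X := if k == n then f else 0.

Lemma delta_bound n f N : \sum_(0 <= k < N) rnorm (delta n f k) <= rnorm f.
Proof.
have [nN|Nn] := ltnP n N.
  rewrite (bigD1_seq n)//= ?iota_uniq ?mem_index_iota// /delta eqxx big1 ?addr0//.
  by move=> k /negPf ->; rewrite rnorm0.
rewrite big_nat big1 ?rnorm_ge0// => k /andP[_ kN].
by rewrite /delta ltn_eqF ?rnorm0// (leq_trans kN).
Qed.

(** The monomial U^n f. *)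
Definition mono n f : bop (ell2 H0) :=
  pi_rep phi rho (Ell1 (ell1_bound (delta_bound n f)).1).

Lemma coefs_mono n f : coefs (mono n f) (delta n f).
Proof. by []. Qed.

Lemma semicrossed_mono n f : semicrossed phi rho (mono n f).
Proof. by apply: subset_closure; eexists. Qed.

Lemma rnorm_mono n f : rnorm (mono n f) <= rnorm f.
Proof. by apply: rnorm_pi_le; exact: delta_bound. Qed.

Lemma toeplitz_delta n f eta j : toeplitz (delta n f) eta j =
  if (n <= j)%N then rho (al (j - n) f) (eta (j - n)%N) else 0.
Proof.
rewrite /toeplitz; case: leqP => [nj|jn].
  rewrite (bigD1 (Ordinal (nj : (n < j.+1)%N)))//= /delta eqxx big1 ?addr0//.
  move=> k /eqP kn; rewrite (_ : (k == n :> nat) = false).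
    by rewrite alpha0 linear0.
  by apply/eqP => kE; apply: kn; exact: val_inj.
rewrite big1// => k _; rewrite /delta ltn_eqF ?alpha0 ?linear0//.
by rewrite (leq_trans _ jn).
Qed.

Lemma cprod_deltal m f t k :
  cprod (delta m f) t k = if (m <= k)%N then C0_mul (al (k - m) f) (t (k - m)%N) else 0.
Proof.
apply/val_inj/funext => x; rewrite [LHS]cprodE; case: leqP => [mk|km].
  have km : (k - m < k.+1)%N by rewrite ltnS leq_subr.
  rewrite (bigD1 (Ordinal km))//= subKn// /delta eqxx iter_alphaE big1 ?addr0//.
  move=> n /eqP nk; rewrite (_ : (k - n == m)%N = false) ?mul0r//.
  by apply/eqP => kn; apply: nk; apply: val_inj; rewrite /= -kn subKn// -ltnS.
rewrite big1// => n _; rewrite /delta ltn_eqF ?mul0r//.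
by rewrite (leq_ltn_trans (leq_subr _ _)).
Qed.

Lemma cprod_deltar n g t k :
  cprod t (delta n g) k = if (n <= k)%N then C0_mul (al n (t (k - n)%N)) g else 0.
Proof.
apply/val_inj/funext => x; rewrite [LHS]cprodE; case: leqP => [nk|kn].
  rewrite (bigD1 (Ordinal (nk : (n < k.+1)%N)))//= /delta eqxx iter_alphaE big1 ?addr0//.
  move=> l /eqP ln; rewrite (_ : (l == n :> nat) = false) ?mulr0//.
  by apply/eqP => lE; apply: ln; exact: val_inj.
rewrite big1// => l _; rewrite /delta ltn_eqF ?mulr0//.
by rewrite (leq_trans _ kn).
Qed.

End Toeplitz.

(** * Completeness of the operators and existence of coefficients *)

Section OperatorCompleteness.
Context {R : realType}.

(** Coordinates converge, and each finite partial energy of a difference passes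
    to the limit with a bound independent of its length. *)
Lemma ell2_complete (V : normedModType R[i]) :
  norm_complete V -> norm_complete (ell2 V).
Proof.
move=> cV F FF cF.
have coord (xi eta : ell2 V) k : rnorm (xi k - eta k) <= rnorm (xi - eta).
  by have := l2norm_coord k (ell2_valP (xi - eta)).
have lk k : exists v : V, (fun xi : ell2 V => xi k) @ F --> v.
  apply: cV => e /cF[xi Fxi]; exists (xi k).
  change (F [set eta : ell2 V | rnorm (xi k - eta k) < e]).
  by apply: filterS Fxi => eta; apply: le_lt_trans.
pose l k := projT1 (cid (lk k)).
have lP k : (fun xi : ell2 V => xi k) @ F --> l k := projT2 (cid (lk k)).
have unif (e : R) : 0 < e ->
    F [set eta : ell2 V | forall J, energy J (fun k => eta k - l k) <= e ^+ 2].
  move=> e0; have [xi Fxi] := cF (e / 2) (divr_gt0 e0 (ltr0Sn _ 1)).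
  apply: filterS (Fxi) => eta /= xe J.
  have el : (fun z : ell2 V => energy J (fun k => eta k - z k)) @ F -->
      (energy J (fun k => eta k - l k) : R^o).
    elim: J => [|J IH].
      rewrite /energy big_geq//; under eq_fun do rewrite big_geq//.
      exact: cvg_cst.
    rewrite /energy big_nat_recr//=; under eq_fun do rewrite big_nat_recr//=.
    apply: (@cvgD _ R^o) => //; set k := J.
    have ck : (fun z : ell2 V => rnorm (eta k - z k) : R^o) @ F --> (rnorm (eta k - l k) : R^o).
      apply: (@cvg_comp _ _ _ (fun z : ell2 V => eta k - z k) (@rnorm R V) F
        (nbhs (eta k - l k))); last exact: rnorm_continuous.
      by apply: cvgB; [exact: cvg_cst|exact: lP].
    by under eq_fun do rewrite expr2; rewrite expr2; apply: cvgM.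
  apply: (cvgr_to_le el).
  apply: filterS (Fxi) => z /= xz.
  apply: le_trans (energy_ell2 J (eta - z)) _.
  rewrite ler_sqr ?nnegrE ?rnorm_ge0 ?(ltW e0)//.
  apply: le_trans (rnorm_triangle xi _ _) _.
  by rewrite (splitr e) lerD// ltW// rnormC.
have lS : l \in sq_summable.
  have [eta /= el] := filter_ex (unif 1 ltr01).
  have [dS _] := energy_le ler01 el.
  have -> : l = (eta : nat -> V) - (fun k => eta k - l k).
    by apply/funext => k; rewrite !fctE opprB addrC subrK.
  by rewrite rpredB// ell2_valP.
exists (Ell2 lS) => U /nbhs_rnormP[e e0 eU].
have e20 : 0 < e / 2 by rewrite divr_gt0.
apply: filterS (unif _ e20) => eta el; apply: eU; rewrite rnormC.
apply: le_lt_trans (_ : _ <= e / 2) _.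
  exact: (energy_le (ltW e20) el).2.
by rewrite ltr_pdivrMr// mulr_natr mulr2n ltrDl.
Qed.

Lemma bop_complete (H : normedModType R[i]) :
  norm_complete H -> norm_complete (bop H).
Proof.
move=> cH F FF cF.
have ev (S T : bop H) x : rnorm (S x - T x) <= rnorm (S - T) * rnorm x.
  exact: (rnorm_bop (S - T)).
have lx x : exists y : H, (fun T : bop H => T x) @ F --> y.
  apply: cH => e e0; have c0 : 0 < rnorm x + 1 by rewrite ltr_wpDl ?rnorm_ge0.
  have [S FS] := cF (e / (rnorm x + 1)) (divr_gt0 e0 c0); exists (S x).
  change (F [set T : bop H | rnorm (S x - T x) < e]).
  apply: filterS FS => T /=; rewrite ltr_pdivlMr//; apply: le_lt_trans.
  by apply: le_trans (ev _ _ _) _; rewrite ler_wpM2l ?rnorm_ge0// lerDl.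
pose l x := projT1 (cid (lx x)).
have lP x (d : R) : 0 < d -> F [set T : bop H | rnorm (l x - T x) < d].
  move=> d0; have := projT2 (cid (lx x)); rewrite -/(l x).
  by move=> /(_ _ (nbhs_rnorm (l x) d0)).
have unif (e : R) : 0 < e ->
    F [set T : bop H | forall x, rnorm (l x - T x) <= e * rnorm x].
  move=> e0; have [S FS] := cF (e / 2) (divr_gt0 e0 (ltr0Sn _ 1)).
  apply: filterS (FS) => T ST x; apply/ler_addgt0Pr => d d0.
  have [T' [ST' lT']] := filter_ex (filterI FS (lP x d d0)).
  have TT' : rnorm (T' - T) <= e.
    apply: le_trans (rnorm_triangle S _ _) _.
    by rewrite (splitr e) lerD//; apply: ltW => //; rewrite rnormC.
  apply: le_trans (rnorm_triangle (T' x) _ _) _.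
  rewrite addrC lerD//; last exact: ltW.
  by apply: le_trans (ev _ _ _) _; rewrite ler_wpM2r ?rnorm_ge0.
have lL : l \in bounded_linear.
  apply/bounded_linearP; split=> [a x y|].
    apply/eqP; rewrite -subr_eq0; apply/eqP/rnorm0_eq0/eqP.
    rewrite eq_le rnorm_ge0 andbT.
    apply: (@le0_of_small _ _ (rnorm (a *: x + y) + (rnorm (a : R[i]^o) * rnorm x + rnorm y))).
    move=> e e0; have [T lT] := filter_ex (unif e e0).
    apply: le_trans (rnorm_triangle (T (a *: x + y)) _ _) _.
    rewrite mulrDr lerD// linearP rnormC opprD addrACA -scalerBr.
    apply: le_trans (rnormD _ _) _; rewrite mulrDr lerD// rnormZ mulrCA.
    by rewrite ler_wpM2l ?rnorm_ge0.
  have [T lT] := filter_ex (unif 1 ltr01).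
  exists (1 + rnorm T) => [|x]; first by rewrite addr_ge0 ?rnorm_ge0.
  rewrite -(subrK (T x) (l x)) mulrDl; apply: le_trans (rnormD _ _) _.
  by rewrite lerD// rnorm_bop.
exists (Bop lL) => U /nbhs_rnormP[e e0 eU].
have e20 : 0 < e / 2 by rewrite divr_gt0.
apply: filterS (unif _ e20) => T lT; apply: eU.
apply: le_lt_trans (_ : _ <= e / 2) _.
  by apply: rnorm_bop_le => [|x]; [exact: ltW|exact: lT].
by rewrite ltr_pdivrMr// mulr_natr mulr2n ltrDl.
Qed.

End OperatorCompleteness.

Section FourierCoefficients.
Context {R : realType} {X : topologicalType} (phi : homeomorphism X).
Context {H0 : normedModType R[i]} {dot : hilbert_dot H0}.
Context (rho : faithful_rep X dot).
Implicit Types (A : bop (ell2 H0)) (B : ell1 R X).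

Lemma semicrossed_approx A (e : R) : semicrossed phi rho A -> 0 < e ->
  exists B, rnorm (A - pi_rep phi rho B) < e.
Proof.
by move=> /[swap] e0 /(_ _ (nbhs_rnorm A e0))[_ [[B _ <-] AB]]; exists B.
Qed.

(** Both sides of the matrix formula depend continuously on the coefficients and
    on the operator, and they agree on the dense image of pi. *)
Lemma coefs_pi_near A t : semicrossed phi rho A ->
  (forall B n, rnorm (B n - t n) <= rnorm (pi_rep phi rho B - A)) ->
  coefs phi rho A t.
Proof.
move=> SA tB xi j; apply/eqP; rewrite -subr_eq0; apply/eqP/rnorm0_eq0/eqP.
rewrite eq_le rnorm_ge0 andbT.
apply: (@le0_of_small _ _ (rnorm xi + \sum_(n < j.+1) rnorm (xi (j - n)%N))).
move=> e e0; have [B AB] := semicrossed_approx SA e0.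
apply: le_trans (rnorm_triangle (pi_rep phi rho B xi j) _ _) _.
rewrite mulrDr lerD//.
  apply: le_trans (l2norm_coord j (ell2_valP ((A - pi_rep phi rho B) xi))) _.
  apply: le_trans (rnorm_bop (A - pi_rep phi rho B) xi) _.
  by rewrite ler_wpM2r ?rnorm_ge0// ltW.
have -> : pi_rep phi rho B xi j - toeplitz phi rho t xi j =
    toeplitz phi rho (fun n => (-1) *: t n + B n) xi j.
  by rewrite toeplitzP scaleN1r addrC.
apply: le_trans (rnorm_sum _) _; rewrite mulr_sumr; apply: ler_sum => n _.
apply: le_trans (rnorm_rep_le _ _ _) _; rewrite ler_wpM2r ?rnorm_ge0//.
apply: le_trans (rnorm_iter_alpha _ _ _) _.
rewrite scaleN1r addrC; apply: le_trans (tB _ _) _.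
by rewrite rnormC ltW.
Qed.

(** The coefficient maps are contractive on the image of pi, so they send the
    trace on it of the neighbourhood filter of A to a Cauchy filter of C_0(X),
    whose limit is by definition the Fourier coefficient. *)
Lemma coefs_fourier A : semicrossed phi rho A ->
  coefs phi rho A (fun m => fourier_coef phi rho m A).
Proof.
move=> SA; apply: coefs_pi_near => // B m.
set F := filter_from (nbhs A) (fun V => pi_rep phi rho @^-1` V).
have FP : ProperFilter F.
  apply: filter_from_proper.
    apply: filter_from_filter; first by exists setT; exact: filterT.
    by move=> U V AU AV; exists (U `&` V) => //; exact: filterI.
  by move=> V /SA[_ [[C _ <-] VC]]; exists C.
have CD (C D : ell1 R X) : rnorm (C m - D m) <= rnorm (pi_rep phi rho C - pi_rep phi rho D).
  exact: (coefs_norm m (coefsB (coefs_pi phi rho C) (coefs_pi phi rho D))).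
have FA (e : R) : 0 < e -> F [set C | rnorm (A - pi_rep phi rho C) < e].
  by move=> e0; exists [set T | rnorm (A - T) < e] => //; exact: nbhs_rnorm.
have [t Ft] : exists t : C0 R X, (fun C : ell1 R X => C m) @ F --> t.
  apply: C0_complete => e e0; have e20 : 0 < e / 2 by rewrite divr_gt0.
  have [C AC] := filter_ex (FA _ e20); exists (C m).
  change (F [set D : ell1 R X | rnorm (C m - D m) < e]).
  apply: filterS (FA _ e20) => D AD; apply: le_lt_trans (CD _ _) _.
  apply: le_lt_trans (rnorm_triangle A _ _) _.
  by rewrite (splitr e) ltrD// rnormC.
have -> : fourier_coef phi rho m A = t by apply: cvg_lim Ft; exact: norm_hausdorff.
apply/ler_addgt0Pr => e e0; have e20 : 0 < e / 2 by rewrite divr_gt0.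
have FtC : F [set C : ell1 R X | rnorm (t - C m) < e / 2] := Ft _ (nbhs_rnorm t e20).
have [C [AC tC]] := filter_ex (filterI (FA _ e20) FtC).
apply: le_trans (rnorm_triangle (C m) _ _) _.
apply: le_trans (lerD (CD B C) (lexx _)) _.
apply: le_trans (lerD (rnorm_triangle A _ _) (lexx _)) _.
by rewrite -addrA lerD// (splitr e) lerD//; apply: ltW => //; rewrite rnormC.
Qed.

End FourierCoefficients.

(** * The weighted estimate *)

Section WeightedEstimate.
Context {R : realType} {X : topologicalType} (phi : homeomorphism X).
Context {H0 : normedModType R[i]} {dot : hilbert_dot H0}.
Context (rho : faithful_rep X dot).
Implicit Types (f g : C0 R X) (t : nat -> C0 R X) (eta : nat -> H0).
Implicit Types (T : bop (ell2 H0)).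

Notation al k f := (iter k (alpha phi) f).
Notation toeplitz := (toeplitz phi rho).
Notation mono := (mono phi rho).

Lemma C0_max f g : exists c : C0 R X,
  forall x, rnorm (c x) = Num.max (rnorm (f x)) (rnorm (g x)).
Proof.
have [a aE] := C0_abs f; have [b bE] := C0_abs g.
have cP : (fun x => (Num.max (rnorm (f x)) (rnorm (g x)))%:C : R[i]^o) \in C0_pred.
  apply: (@C0_dominated _ _ _ (a + b) 1) => [|x].
    apply: continuous_real_complex => x.
    by apply: (@continuous_max _ _ _ _ x); exact: C0_rnorm_continuous.
  have -> : (a + b) x = (rnorm (f x) + rnorm (g x))%:C by rewrite rmorphD/= -aE -bE.
  rewrite mul1r !rnorm_real !ger0_norm ?addr_ge0 ?le_max ?rnorm_ge0//.
  by rewrite ge_max lerDl lerDr !rnorm_ge0.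
exists (MkC0 cP) => x.
by rewrite /= rnorm_real ger0_norm// le_max rnorm_ge0.
Qed.

(** The function w i has modulus max over i <= k < J of |f o phi^k|: the smallest
    decreasing majorant on the first J indices.  Its values are values of f
    further along the orbit, so a bound on products along orbits survives. *)
Lemma monotone_majorant f J : exists w : nat -> C0 R X,
  [/\ forall i x, rnorm (w i.+1 x) <= rnorm (w i x),
      forall i x, (i < J)%N -> rnorm (al i f x) <= rnorm (w i x) &
      forall i x, exists l, rnorm (w i x) <= rnorm (f (iter (i + l) phi x))].
Proof.
elim: J f => [|J IH] f.
  by exists (fun=> 0); split=> // i x; exists 0%N; rewrite rnorm0 rnorm_ge0.
have [w [wd wf wl]] := IH (alpha phi f).
have [c cE] := C0_max f (w 0%N).
exists (fun i => if i is i'.+1 then w i' else c); split=> [[|i] x|[|i] x iJ|[|i] x].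
- by rewrite cE le_max lexx orbT.
- exact: wd.
- by rewrite cE le_max lexx.
- by rewrite iterSr; exact: wf.
- rewrite cE; have [wx|fx] := leP (rnorm (f x)) (rnorm (w 0%N x)).
    by have [l wxl] := wl 0%N x; exists l.+1.
  by exists 0%N.
- by have [l wxl] := wl i x; exists l; rewrite addSn.
Qed.

Lemma energy_shift m eta J :
  energy J (fun k => if (m <= k)%N then eta (k - m)%N else 0) <= energy J eta.
Proof.
have [Jm|mJ] := leqP J m.
  rewrite {1}/energy big_nat big1 ?energy_ge0// => k /andP[_ kJ].
  by rewrite leqNgt (leq_trans kJ Jm) rnorm0 expr0n.
rewrite {1}/energy (big_cat_nat (n := m))//=; last exact: ltnW.
rewrite big_nat big1 ?add0r => [|k /andP[_ km]]; last first.
  by rewrite leqNgt km rnorm0 expr0n.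
rewrite -{1}(add0n m) big_addn.
apply: le_trans (energy_mono eta (leq_subr m J)).
by apply: ler_sum => k _; rewrite leq_addl addnK.
Qed.

(** Abel summation: put |c_k|^2 = |w_k|^2 - |w_(k+1)|^2.  The weighted energy is
    then the sum over k of the energies of the first k + 1 coordinates weighted
    by the constant c_k, and since rho (c_k) commutes with T each of them is
    bounded by lower triangularity. *)
Lemma energy_decreasing_weights T t (w : nat -> C0 R X) J eta :
  coefs phi rho T t ->
  (forall i x, rnorm (w i.+1 x) <= rnorm (w i x)) ->
  energy J (fun i => rho (w i) (toeplitz t eta i)) <=
  rnorm T ^+ 2 * energy J (fun i => rho (w i) (eta i)).
Proof.
move=> tT wd; pose w' i : C0 R X := if (i < J)%N then w i else 0.
have w'd i x : rnorm (w' i.+1 x) <= rnorm (w' i x).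
  rewrite /w'; case: ifP => [iJ|_]; first by rewrite (ltnW iJ).
  by rewrite rnorm0 rnorm_ge0.
have cP i : exists c : C0 R X, forall x,
    rnorm (c x) ^+ 2 = rnorm (w' i x) ^+ 2 - rnorm (w' i.+1 x) ^+ 2.
  by apply: C0_sub_sqr => x; rewrite ler_sqr ?nnegrE ?rnorm_ge0.
pose c i := projT1 (cid (cP i)).
have cE i x : rnorm (c i x) ^+ 2 = rnorm (w' i x) ^+ 2 - rnorm (w' i.+1 x) ^+ 2.
  exact: (projT2 (cid (cP i))).
have layers zeta : energy J (fun i => rho (w i) (zeta i)) =
    \sum_(0 <= k < J) energy k.+1 (fun i => rho (c k) (zeta i)).
  (* As w' vanishes at J, the |c_k|^2 with i <= k < J telescope to |w_i|^2. *)
  transitivity (\sum_(0 <= i < J) \sum_(0 <= k < J | (i <= k)%N)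
      rnorm (rho (c k) (zeta i)) ^+ 2).
    apply: eq_big_nat => i /andP[_ iJ].
    rewrite (big_cat_nat (n := i))//=; last exact: ltnW.
    rewrite big_nat_cond big1 ?add0r => [|k /andP[/andP[_ ki]]]; last first.
      by rewrite leqNgt ki.
    rewrite big_nat_cond (eq_bigl (fun k => (i <= k < J)%N)); last first.
      by move=> k; case: (leqP i k); rewrite ?andbT ?andbF.
    rewrite -big_nat; apply: rep_pythagoras => x.
    under eq_bigr do rewrite cE.
    have -> : rnorm (w i x) ^+ 2 = - (rnorm (w' J x) ^+ 2 - rnorm (w' i x) ^+ 2).
      by rewrite /w' ltnn iJ rnorm0 expr0n sub0r opprK.
    rewrite -(telescope_sumr (fun k => rnorm (w' k x) ^+ 2)) ?(ltnW iJ)//.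
    by rewrite -sumrN; apply: eq_bigr => k _; rewrite opprB.
  rewrite (exchange_big_dep_nat xpredT)//=; apply: eq_big_nat => k /andP[_ kJ].
  by rewrite /energy [RHS](big_nat_widen _ _ J).
rewrite !layers mulr_sumr; apply: ler_sum => k _.
apply: le_trans (energy_toeplitz _ k.+1 tT).
by apply: ler_sum => i _; rewrite toeplitz_rep.
Qed.

(** For T = U^l h this is immediate; for general T the coefficients cannot be
    added up, and the weights f o phi^i are replaced by a decreasing majorant,
    moved across T, and only there multiplied by g. *)
Lemma rnorm_sandwich T t m n f g (M : R) : coefs phi rho T t -> 0 <= M ->
  (forall l x, rnorm (f (iter (n + l) phi x) * g x : R[i]^o) <= M) ->
  rnorm (bop_comp (mono m f) (bop_comp T (mono n g))) <= M * rnorm T.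
Proof.
move=> tT M0 fgM.
have cs := coefs_comp (coefs_mono phi rho m f) (coefs_comp tT (coefs_mono phi rho n g)).
apply: (rnorm_coefs_le cs) => [|xi J]; first by rewrite mulr_ge0 ?rnorm_ge0.
pose eta := toeplitz (delta n g) xi.
have [w [wd wf wl]] := monotone_majorant f J.
apply: le_trans (_ : _ <= energy J (fun i => rho (al i f) (toeplitz t eta i))) _.
  apply: le_trans (energy_shift m (fun i => rho (al i f) (toeplitz t eta i)) J).
  apply: ler_sum => k _; rewrite toeplitz_cprod toeplitz_delta.
  case: leqP => // _; rewrite (_ : toeplitz (cprod phi t (delta n g)) xi (k - m) =
    toeplitz t eta (k - m))//.
  exact: toeplitz_cprod.
apply: le_trans (_ : _ <= energy J (fun i => rho (w i) (toeplitz t eta i))) _.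
  rewrite /energy [leLHS]big_nat [leRHS]big_nat; apply: ler_sum => i /andP[_ iJ].
  have := @rep_dominated _ _ _ _ rho (fun=> w i) [:: 0%N] (al i f) (toeplitz t eta i).
  rewrite big_cons big_nil addr0; apply => x; rewrite big_cons big_nil addr0.
  by rewrite ler_sqr ?nnegrE ?rnorm_ge0// wf.
apply: le_trans (energy_decreasing_weights J eta tT wd) _.
have -> : (M * rnorm T) ^+ 2 * rnorm xi ^+ 2 =
  rnorm T ^+ 2 * (M ^+ 2 * rnorm xi ^+ 2) by ring.
apply: ler_wpM2l; first exact: sqr_ge0.
apply: le_trans (_ : _ <= M ^+ 2 * energy J xi) _; last first.
  by rewrite ler_wpM2l ?sqr_ge0 ?energy_ell2.
apply: le_trans (ler_wpM2l (sqr_ge0 M) (energy_shift n xi J)).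
rewrite mulr_sumr; apply: ler_sum => i _; rewrite -exprMn.
rewrite ler_sqr ?nnegrE ?mulr_ge0 ?rnorm_ge0// /eta toeplitz_delta.
case: leqP => [ni|_]; last by rewrite linear0 rnorm0 mulr0.
rewrite -rep_mulE; apply: le_trans (rnorm_rep_le _ _ _) _.
rewrite ler_wpM2r ?rnorm_ge0// rnorm_C0E; apply: supnorm_le => // x _.
have [l wxl] := wl i x; rewrite /= rnormM iter_alphaE.
apply: le_trans (fgM l (iter (i - n) phi x)); rewrite rnormM -iterD.
by rewrite addnAC subnKC// ler_wpM2r ?rnorm_ge0.
Qed.

End WeightedEstimate.

(** * Fejér means *)

Section FejerMeans.
Context {R : realType} {X : topologicalType} (phi : homeomorphism X).
Context {H0 : normedModType R[i]} {dot : hilbert_dot H0}.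
Context (rho : faithful_rep X dot).
Implicit Types (t : nat -> C0 R X) (A T : bop (ell2 H0)).

Notation toeplitz := (toeplitz phi rho).
Notation coefs := (coefs phi rho).
Notation mono := (mono phi rho).

(** Truncated subtraction makes the weight of U^n vanish for N <= n. *)
Definition fejer_weight N n : R := (N - n)%:R / N%:R.

Definition fejer N t : bop (ell2 H0) :=
  \sum_(n < N) (fejer_weight N n)%:C *: mono n (t n).

Lemma coefs_fejer N t :
  coefs (fejer N t) (fun k => (fejer_weight N k)%:C *: t k).
Proof.
have h (n : 'I_N) : coefs ((fejer_weight N n)%:C *: mono n (t n))
    (fun k => (fejer_weight N n)%:C *: delta n (t n) k).
  rewrite -[_ *: mono _ _]addr0.
  apply: eq_coefs (coefsP _ (coefs_mono phi rho n (t n)) (coefs0 phi rho)) => k.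
  by rewrite addr0.
apply: eq_coefs (coefs_sum h) => k; have [kN|Nk] := ltnP k N.
  rewrite (bigD1 (Ordinal kN))//= /delta eqxx big1 ?addr0// => n /eqP nk.
  rewrite (_ : (k == n :> nat) = false) ?scaler0//.
  by apply/eqP => kE; apply: nk; exact: val_inj.
rewrite /fejer_weight (eqP Nk) mul0r scale0r big1// => n _.
by rewrite /delta gtn_eqF ?scaler0// (leq_trans _ Nk).
Qed.

Let window (N s : nat) (xi : nat -> H0) i := if (i <= s < i + N)%N then xi i else 0.

(** The entry in row k and column k - n survives in the windows s = k + p with
    p < N - n, which are N - n among the N windows containing k. *)
Lemma fejer_windows N t xi k : N%:R *: toeplitz (fun n => (fejer_weight N n)%:C *: t n) xi k =
  \sum_(p < N) toeplitz t (window N (k + p) xi) k.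
Proof.
case: N => [|N]; first by rewrite big_ord0 scale0r.
rewrite exchange_big scaler_sumr; apply: eq_bigr => n _.
have nk : (n <= k)%N by rewrite -ltnS.
have alZ c f j : iter j (alpha phi) (c *: f : C0 R X) = c *: iter j (alpha phi) f.
  by have := alphaP phi j c f 0; rewrite alpha0 !addr0.
rewrite alZ linearZ.
set v := rho (iter (k - n) (alpha phi) (t n)) (xi (k - n)%N).
transitivity ((N.+1 - n)%:R *: v : H0).
  rewrite [X in _ *: X](_ : _ = (fejer_weight N.+1 n)%:C *: v)// scalerA.
  congr (_ *: _); rewrite /fejer_weight rmorphM/= fmorphV/= !rmorph_nat.
  by rewrite mulrCA divff ?mulr1// pnatr_eq0.
transitivity (\sum_(p < N.+1 | (p < N.+1 - n)%N) v).
  by rewrite (big_ord_narrow (leq_subr n N.+1)) sumr_const card_ord scaler_nat.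
rewrite big_mkcond; apply: eq_bigr => p _; rewrite /window ltn_subRL addnC.
rewrite (leq_trans (leq_subr _ _) (leq_addr _ _)) /=.
have -> : (k + p < k - n + N.+1)%N = (p + n < N.+1)%N.
  by rewrite -{1}(subnK nk) -addnA ltn_add2l addnC.
by case: ifP => // _; rewrite linear0.
Qed.

(** The Fejér mean is the average over the windows of length N of the
    compressions of T.  Every coordinate meets N windows, on both sides of T, so
    the Cauchy-Schwarz inequality gives a bound free of N. *)
Lemma rnorm_fejer N T t : coefs T t -> rnorm (fejer N t) <= rnorm T.
Proof.
move=> tT; case: N => [|N].
  by rewrite /fejer big_ord0 rnorm0 rnorm_ge0.
apply: (rnorm_coefs_le (coefs_fejer N.+1 t)) => [|xi J]; first exact: rnorm_ge0.
set u := toeplitz _ _; pose n : R := N.+1%:R; have n0 : 0 < n by rewrite ltr0Sn.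
pose w s := window N.+1 s xi; pose F s k := rnorm (toeplitz t (w s) k) ^+ 2.
rewrite -(ler_pM2l (exprn_gt0 2 n0)).
apply: le_trans (_ : _ <= n * \sum_(0 <= k < J) \sum_(p < N.+1) F (k + p)%N k) _.
  rewrite !mulr_sumr; apply: ler_sum => k _; rewrite -exprMn.
  have -> : n * rnorm (u k) = rnorm (\sum_(p < N.+1) toeplitz t (w (k + p)%N) k).
    rewrite /w -fejer_windows rnormZ -(rmorph_nat (real_complex R)) rnorm_real.
    by rewrite ger0_norm ?ltW.
  apply: le_trans (sqr_sum_le _ (fun p => rnorm (toeplitz t (w (k + p)%N) k))).
  rewrite ler_sqr ?nnegrE ?rnorm_ge0//; first exact: rnorm_sum.
  by apply: sumr_ge0 => p _; exact: rnorm_ge0.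
rewrite (expr2 n) -(mulrA n) ler_pM2l//.
apply: le_trans (_ : _ <= \sum_(0 <= s < J + N.+1) \sum_(0 <= k < J) F s k) _.
  rewrite exchange_big_nat/= big_nat [leRHS]big_nat; apply: ler_sum => k /andP[_ kJ].
  rewrite -(big_mkord xpredT (fun p => F (k + p)%N k)).
  have -> : \sum_(0 <= p < N.+1) F (k + p)%N k = \sum_(k <= s < k + N.+1) F s k.
    rewrite -{3}[k]add0n big_addn addKn.
    by apply: eq_bigr => p _; rewrite addnC.
  rewrite [leRHS](big_cat_nat (n := k))//=; last by rewrite ltnW// ltn_addr.
  rewrite [X in _ + X](big_cat_nat (n := (k + N.+1)%N))/= ?leq_addr ?leq_add2r ?(ltnW kJ)//.
  by rewrite addrCA lerDl addr_ge0// sumr_ge0// => s _; exact: sqr_ge0.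
apply: le_trans (_ : _ <= rnorm T ^+ 2 * \sum_(0 <= s < J + N.+1) energy J (w s)) _.
  by rewrite mulr_sumr; apply: ler_sum => s _; exact: energy_toeplitz.
rewrite mulrCA ler_wpM2l ?sqr_ge0//.
apply: le_trans (ler_wpM2l (ltW n0) (energy_ell2 J xi)).
rewrite /energy exchange_big_nat/= mulr_sumr big_nat [leRHS]big_nat.
apply: ler_sum => k /andP[_ kJ].
rewrite [leLHS](big_cat_nat (n := k))//=; last by rewrite ltnW// ltn_addr.
rewrite [X in _ + X <= _](big_cat_nat (n := (k + N.+1)%N))/= ?leq_addr ?leq_add2r ?(ltnW kJ)//.
rewrite big_nat big1 ?add0r => [|s /andP[_ sk]]; last first.
  by rewrite /w /window leqNgt sk rnorm0 expr0n.
rewrite [X in _ + X]big_nat [X in _ + X]big1 ?addr0 => [|s /andP[ks _]]; last first.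
  by rewrite /w /window [X in _ && X]ltnNge ks andbF rnorm0 expr0n.
rewrite (eq_big_nat _ _ (F2 := fun=> rnorm (xi k) ^+ 2)) => [|s ks]; last first.
  by rewrite /w /window ks.
by rewrite sumr_const_nat addKn mulr_natl.
Qed.

(** In the l^1 norm: the coefficients beyond some M form a small tail, and those
    before M change by at most the fraction M / N of themselves. *)
Lemma rnorm_pi_fejer (B : ell1 R X) (e : R) : 0 < e ->
  exists2 N, (0 < N)%N & rnorm (pi_rep phi rho B - fejer N B) <= e.
Proof.
move=> e0; pose S N := \sum_(0 <= n < N) rnorm (B n).
pose L := limn S; have cB : cvgn S := @ell1_valP _ _ B.
have SL N : S N <= L.
  apply: nondecreasing_cvgn_le => //.
  by apply/nondecreasing_series => n _ _; exact: rnorm_ge0.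
have L0 : 0 <= L by have := SL 0%N; rewrite /S big_geq.
have e20 : 0 < e / 2 by rewrite divr_gt0.
have [M LM] : exists M, L - S M < e / 2.
  have /(@cvgrPdist_lt _ R^o)/(_ _ e20) : S @ \oo --> (L : R^o) := cB.
  move=> [M _ /(_ M (leqnn M))/=]; rewrite ger0_norm ?subr_ge0//.
  by exists M.
pose N := (Num.truncn ((e / 2)^-1 * (M%:R * L))).+1.
have N0 : 0 < N%:R :> R by rewrite ltr0Sn.
have MN : M%:R * L / N%:R <= e / 2.
  rewrite ler_pdivrMr// -ler_pdivrMl//; apply: ltW.
  exact: truncnS_gt.
exists N => //; pose c n : R := fejer_weight N n.
have c01 n : 0 <= 1 - c n <= 1.
  rewrite subr_ge0 gerBl /c /fejer_weight divr_ge0// andbT ler_pdivrMr//.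
  by rewrite mul1r ler_nat leq_subr.
have cM n : 1 - c n <= M%:R / N%:R + (M <= n)%N%:R.
  case: leqP => [Mn|nM].
    by apply: le_trans (andP (c01 n)).2 _; rewrite lerDr divr_ge0.
  have -> : 1 - c n = (N%:R - (N - n)%:R) / N%:R.
    by rewrite mulrBl divff// lt0r_neq0.
  rewrite addr0.
  rewrite ler_pM2r ?invr_gt0// lerBlDr -natrD ler_nat.
  by rewrite -leq_subLR leq_sub2l// ltnW.
pose B' n := (1 - c n)%:C *: B n.
have B'n n : rnorm (B' n) = (1 - c n) * rnorm (B n).
  by have /andP[c0 _] := c01 n; rewrite rnormZ rnorm_real ger0_norm.
have B'e K : \sum_(0 <= n < K) rnorm (B' n) <= e.
  apply: le_trans (_ : _ <= \sum_(0 <= n < K) (M%:R / N%:R * rnorm (B n) +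
      (M <= n)%N%:R * rnorm (B n))) _.
    apply: ler_sum => n _; rewrite B'n -mulrDl.
    by rewrite ler_wpM2r ?rnorm_ge0.
  rewrite big_split/= -mulr_sumr (splitr e) lerD//.
    apply: le_trans MN; rewrite mulrAC ler_wpM2r ?invr_ge0 ?(ltW N0)//.
    by rewrite ler_wpM2l//; exact: SL.
  apply: le_trans (ltW LM); have [KM|/ltnW MK] := leqP K M.
    rewrite big_nat big1 ?subr_ge0// => n /andP[_ nK].
    by rewrite leqNgt (leq_trans nK KM) mul0r.
  rewrite lerBrDl; apply: le_trans (SL K).
  rewrite /S [leRHS](big_cat_nat (n := M))//= lerD2l.
  rewrite (big_cat_nat (n := M))//= big_nat big1 ?add0r => [|n /andP[_ nM]]; last first.
    by rewrite leqNgt nM mul0r.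
  by rewrite big_nat [leRHS]big_nat; apply: ler_sum => n /andP[-> _]; rewrite mul1r.
pose D := Ell1 (ell1_bound B'e).1.
rewrite (_ : pi_rep phi rho B - fejer N B = pi_rep phi rho D); first exact: rnorm_pi_le.
apply: (coefs_inj (t := B')); last exact: coefs_pi.
apply: eq_coefs (coefsB (coefs_pi phi rho B) (coefs_fejer N B)) => k.
by rewrite /B' rmorphB scalerBl scale1r.
Qed.

Lemma fejer_cvg A t (e : R) : semicrossed phi rho A -> coefs A t -> 0 < e ->
  exists N, rnorm (A - fejer N t) < e.
Proof.
move=> SA tA e0.
have e30 : 0 < e / 3 by rewrite divr_gt0.
have [B AB] := semicrossed_approx SA e30.
have [N N0 BN] := rnorm_pi_fejer B e30; exists N.
have Bt : rnorm (fejer N B - fejer N t) <= rnorm (A - pi_rep phi rho B).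
  rewrite (_ : fejer N B - fejer N t = fejer N (fun n => B n - t n)).
    by rewrite rnormC rnorm_fejer//; apply: coefsB => //; exact: coefs_pi.
  apply: coefs_inj (coefs_fejer _ _).
  apply: eq_coefs (coefsB (coefs_fejer N B) (coefs_fejer N t)) => k.
  by rewrite scalerBr.
apply: le_lt_trans (rnorm_triangle (pi_rep phi rho B) _ _) _.
apply: le_lt_trans (lerD (lexx _) (rnorm_triangle (fejer N B) _ _)) _.
exact: add3_lt AB BN (le_lt_trans Bt AB).
Qed.

End FejerMeans.

(** * Orbits, bump functions and precompact families *)

Section Bumps.
Context {R : realType} {X : topologicalType}.

Lemma metrizable_hausdorff (p q : X) : metrizable R X -> p <> q ->
  exists U V : set X, [/\ nbhs p U, nbhs q V & forall y, U y -> ~ V y].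
Proof.
move=> [d [d0 dE dC dT dN]] pq; pose r := d p q / 2.
have r0 : 0 < r.
  by rewrite divr_gt0// lt_def d0 andbT; apply/eqP => /dE.
exists [set y | d p y < r], [set y | d q y < r]; split=> [||y /= py qy].
- by apply/dN; exists r.
- by apply/dN; exists r.
have := dT p y q; rewrite leNgt (dC y); apply/negP; rewrite negbK.
by rewrite (splitr (d p q)) ltrD.
Qed.

Lemma metrizable_nbhs_neq (p q : X) : metrizable R X -> p <> q ->
  nbhs p [set y | y <> q].
Proof.
move=> mX /(metrizable_hausdorff mX)[U [V [Up Vq UV]]].
apply: filterS Up => y Uy yq; apply: (UV y Uy); rewrite yq.
exact: nbhs_singleton.
Qed.

Lemma C0_bump (p : X) (U : set X) : metrizable R X -> locally_compact [set: X] ->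
  nbhs p U -> exists h : C0 R X,
    [/\ h p = 1, forall y, ~ U y -> h y = 0 & rnorm h <= 1].
Proof.
move=> [d [d0 dE dC dT dN]] lX pU.
have [K pK [cK _]] := lX p I.
have {}pK : nbhs p [set y | [set: X] y -> K y] := pK.
have /dN[r r0 rUK] : nbhs p (U `&` K).
  by apply: filterI => //; apply: filterS pK => y; exact.
pose h y : R := Num.max 0 (1 - d p y / r).
have h01 y : 0 <= h y <= 1.
  rewrite /h le_max lexx/= ge_max ler01/= gerBl.
  by rewrite divr_ge0// ltW.
have hout y : ~ (U `&` K) y -> h y = 0.
  move=> nUK; apply/max_idPl; rewrite subr_le0 ler_pdivlMr// mul1r leNgt.
  by apply/negP => /rUK.
have dcont : continuous (fun y => d p y : R^o).
  move=> x; apply/(@cvgrPdist_lt _ R^o) => e e0.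
  apply/dN; exists e => // y /= xy; apply: le_lt_trans xy.
  rewrite ler_norml lerBlDr lerNl opprB lerBlDr (addrC (d x y)) dT.
  by rewrite (dC x) addrC dT.
have hcont : continuous (h : X -> R^o).
  move=> x; apply: (@continuous_max _ _ _ _ x); first exact: cvg_cst.
  apply: (@cvgB _ R^o); first exact: cvg_cst.
  by apply: cvgMl; exact: dcont.
have hC0 : (fun y => (h y)%:C : R[i]^o) \in C0_pred.
  apply/C0_predP; split=> [|e e0]; first exact: continuous_real_complex.
  exists K => // y Ky; rewrite hout ?rnorm0//.
  by case.
exists (MkC0 hC0); split=> [|y Uy|] /=.
- have d00 : d p p = 0 by apply/dE.
  by rewrite /h d00 mul0r subr0; congr (_%:C); apply/max_idPr.
- by rewrite hout// => -[].
rewrite rnorm_C0E; apply: supnorm_le => // x _ /=.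
by rewrite rnorm_real ger0_norm; have /andP[] := h01 x.
Qed.

End Bumps.

Section Orbits.
Context {X : topologicalType} (phi : homeomorphism X).

Lemma iter_continuous n : continuous (iter n phi).
Proof.
elim: n => [|n IH] x; first exact: cvg_id.
exact: continuous_comp (IH x) (@homeo_continuous _ phi _).
Qed.

Lemma iter_inj n : injective (iter n phi).
Proof.
elim: n => [//|n IH] x y /= E; apply: IH.
exact: (can_inj (@homeo_funK _ phi)) E.
Qed.

Lemma periodic_recurrent p x : (0 < p)%N -> iter p phi x = x -> recurrent phi x.
Proof.
move=> p0 px; exists (fun k => (k * p)%N) => [j k jk|].
  by rewrite ltn_pmul2r.
have -> : (fun k => iter (k * p) phi x) = fun=> x; last exact: cvg_cst.
apply/funext => k; elim: k => [//|k IH].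
by rewrite mulSn iterD IH.
Qed.

Lemma recurrent_iter i x : recurrent phi x -> recurrent phi (iter i phi x).
Proof.
move=> [n hn nx]; exists n => //.
have -> : (fun k => iter (n k) phi (iter i phi x)) =
    iter i phi \o (fun k => iter (n k) phi x).
  by apply/funext => k; rewrite /= -!iterD addnC.
exact: (cvg_comp _ _ nx (@iter_continuous i x)).
Qed.

Lemma nonrecurrent_orbit_inj x j k : ~ recurrent phi x ->
  iter j phi x = iter k phi x -> j = k.
Proof.
move=> nx; wlog jk : j k / (j <= k)%N => [H E|].
  by have [/H|/ltnW/H] := leqP j k; [exact|move=> ->].
rewrite -(subnK jk) addnC iterD => /iter_inj /esym E.
have [->|kj] := posnP (k - j); first by rewrite addn0.
by case: nx; exact: periodic_recurrent E.
Qed.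

Lemma recurrent_return x (U : set X) k : recurrent phi x -> nbhs x U ->
  exists2 n, (k <= n)%N & U (iter n phi x).
Proof.
move=> [n hn nx] xU; have [K _ KU] := nx _ xU.
have le_n j : (j <= n j)%N.
  by elim: j => // j IH; apply: leq_ltn_trans IH (hn _ _ (ltnSn j)).
exists (n (maxn k K)); first exact: leq_trans (leq_maxl _ _) (le_n _).
by apply: KU; exact: leq_maxr.
Qed.

End Orbits.

Section PrecompactCoefficients.
Context {R : realType} {X : topologicalType} (phi : homeomorphism X).
Context {H0 : normedModType R[i]} {dot : hilbert_dot H0}.
Context (rho : faithful_rep X dot).
Implicit Types (B : bop (ell2 H0)) (b : nat -> C0 R X).

Notation coefs := (coefs phi rho).

(** The Riemann-Lebesgue property, which passes from polynomials to limits. *)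
Definition null_coefs B := exists2 b, coefs B b &
  forall e : R, 0 < e -> exists k0, forall k, (k0 <= k)%N -> rnorm (b k) <= e.

Context (K : set (bop (ell2 H0))) (pK : precompact K).
Context (nK : forall B, K B -> null_coefs B).

(** Each of the finitely many centres of a net has coefficients tending to
    zero, and the coefficient maps are contractive. *)
Lemma precompact_coefs_null (e : R) : 0 < e ->
  exists k0, forall B b k, K B -> coefs B b -> (k0 <= k)%N -> rnorm (b k) <= e.
Proof.
move=> e0; have e20 : 0 < e / 2 by rewrite divr_gt0.
have [s sK Ks] := precompact_net pK e20.
have [k0 k0P] : exists k0, forall c b k, c \in s -> coefs c b -> (k0 <= k)%N ->
    rnorm (b k) <= e / 2.
  elim: s sK {Ks} => [|c s IH] sK; first by exists 0%N.
  have [d ds|k1 k1P] := IH; first by apply: sK; rewrite inE ds orbT.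
  have [b cb /(_ _ e20)[k2 k2P]] := nK (sK c (mem_head _ _)).
  exists (maxn k1 k2) => d b' k; rewrite geq_max inE => /orP[/eqP->|ds] db /andP[k1k k2k].
    by rewrite (coefs_unique db cb) k2P.
  exact: k1P ds db k1k.
exists k0 => B b k KB Bb k0k; have [c cs Bc] := Ks B KB.
have [b' cb _] := nK (sK c cs).
rewrite -(subrK (b' k) (b k)); apply: le_trans (rnormD _ _) _.
rewrite (splitr e) lerD//; last exact: k0P cs cb k0k.
by apply: le_trans (ltW Bc); exact: coefs_norm (coefsB Bb cb).
Qed.

(** For a single centre, all but finitely many coefficients are small, and
    finitely many continuous functions are equicontinuous at x. *)
Lemma precompact_coefs_equicontinuous (e : R) x : 0 < e ->
  nbhs x [set y | forall B b k, K B -> coefs B b -> rnorm (b k x - b k y) < e].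
Proof.
move=> e0; have e30 : 0 < e / 3 by rewrite divr_gt0.
have [s sK Ks] := precompact_net pK e30.
have [k0 k0P] := precompact_coefs_null (divr_gt0 e30 (ltr0Sn _ 1)).
have near_c c : c \in s ->
    nbhs x [set y | forall b k, coefs c b -> rnorm (b k x - b k y) <= e / 3].
  move=> cs; have [b cb _] := nK (sK c cs).
  have : nbhs x [set y | forall k, (k < k0)%N -> rnorm (b k x - b k y) <= e / 3].
    elim: k0 {k0P} => [|j IH]; first exact: filterE.
    apply: filterS (filterI IH (C0_near (b j) x e30)) => y [yj yb] k.
    by rewrite ltnS leq_eqVlt => /orP[/eqP->|/yj//]; exact: ltW.
  apply: filterS => y yk b' k cb'; rewrite (coefs_unique cb' cb).
  have [/yk//|k0k] := ltnP k k0.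
  apply: le_trans (rnormD _ _) _; rewrite rnormN (splitr (e / 3)).
  have bk := k0P c b k (sK c cs) cb k0k.
  by rewrite lerD//; apply: le_trans bk; exact: rnorm_C0.
have : nbhs x [set y | forall c b k, c \in s -> coefs c b ->
    rnorm (b k x - b k y) <= e / 3].
  elim: s {sK Ks} near_c => [|c s IH] near_c; first exact: filterE.
  have {}IH := IH (fun c' c's => near_c c' (mem_behead (s := c :: s) c's)).
  apply: filterS (filterI (near_c c (mem_head _ _)) IH) => y [yc ys] c' b k.
  by rewrite inE => /orP[/eqP->|]; [exact: yc|exact: ys].
apply: filterS => y ys B b k KB Bb; have [c cs Bc] := Ks B KB.
have [b' cb _] := nK (sK c cs).
have bb' z : rnorm (b k z - b' k z) < e / 3.
  apply: le_lt_trans Bc; apply: le_trans (coefs_norm k (coefsB Bb cb)).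
  exact: (rnorm_C0 (b k - b' k)).
apply: le_lt_trans (rnorm_triangle (b' k x) _ _) _.
apply: le_lt_trans (lerD (lexx _) (rnorm_triangle (b' k y) _ _)) _.
by apply: add3_lt (bb' x) (ys c b' k cs cb) _; rewrite rnormC; exact: bb'.
Qed.

End PrecompactCoefficients.

(** * Compact elements satisfy the conditions *)

Section CompositionNorms.
Context {R : realType} {H : normedModType R[i]}.
Implicit Types S T A : bop H.

Lemma rnorm_bop_comp S T : rnorm (bop_comp S T) <= rnorm S * rnorm T.
Proof.
apply: rnorm_bop_le => [|x]; first by rewrite mulr_ge0 ?rnorm_ge0.
apply: le_trans (rnorm_bop S (T x)) _; rewrite -mulrA.
by rewrite ler_wpM2l ?rnorm_ge0// rnorm_bop.
Qed.

Lemma bop_compDl S1 S2 T : bop_comp (S1 + S2) T = bop_comp S1 T + bop_comp S2 T.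
Proof. exact/val_inj/funext. Qed.

Lemma bop_compDr S T1 T2 : bop_comp S (T1 + T2) = bop_comp S T1 + bop_comp S T2.
Proof. by apply/val_inj/funext => x; exact: linearD. Qed.

Lemma bop_compNl S T : bop_comp (- S) T = - bop_comp S T.
Proof. exact/val_inj/funext. Qed.

Lemma bop_compNr S T : bop_comp S (- T) = - bop_comp S T.
Proof. by apply/val_inj/funext => x; exact: linearN. Qed.

Lemma sandwich_dist S A T :
  rnorm (bop_comp A (bop_comp T A) - bop_comp S (bop_comp T S)) <=
  rnorm (A - S) * (rnorm A + rnorm S) * rnorm T.
Proof.
have -> : bop_comp A (bop_comp T A) - bop_comp S (bop_comp T S) =
    bop_comp (A - S) (bop_comp T A) + bop_comp S (bop_comp T (A - S)).
  by rewrite bop_compDl bop_compNl !bop_compDr !bop_compNr addrA subrK.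
apply: le_trans (rnormD _ _) _; rewrite -mulrA mulrDl mulrDr lerD//.
  apply: le_trans (rnorm_bop_comp _ _) _; rewrite ler_wpM2l ?rnorm_ge0//.
  by rewrite mulrC rnorm_bop_comp.
apply: le_trans (rnorm_bop_comp _ _) _; rewrite mulrCA ler_wpM2l ?rnorm_ge0//.
by rewrite mulrC rnorm_bop_comp.
Qed.

End CompositionNorms.

Section Necessity.
Context {R : realType} {X : topologicalType} (phi : homeomorphism X).
Context {H0 : normedModType R[i]} {dot : hilbert_dot H0}.
Context (rho : faithful_rep X dot).
Implicit Types (f : nat -> C0 R X) (h : C0 R X) (A : bop (ell2 H0)).

Notation coefs := (coefs phi rho).
Notation mono := (mono phi rho).

Lemma sandwich_coefE f h l N x : cprod phi f (cprod phi (delta l h) f) (N + l) x =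
  \sum_(n < N.+1) f (N - n)%N (iter (n + l) phi x) * (h (iter n phi x) * f n x).
Proof.
rewrite cprodE -(big_mkord xpredT (fun k => f (N + l - k)%N (iter k phi x) *
  cprod phi (delta l h) f k x)) -addSn.
rewrite (big_cat_nat (n := l)) ?leq_addl//= big_nat big1 ?add0r => [|k /andP[_ kl]]; last first.
  by rewrite cprod_deltal leqNgt kl mulr0.
rewrite -{1}[l]add0n big_addn addnK big_mkord; apply: eq_bigr => n _.
by rewrite cprod_deltal leq_addl addnK subnDr /= iter_alphaE.
Qed.

(** Replacing A by a Fejér mean leaves finitely many nonzero coefficients. *)
Lemma sandwich_null_coefs A f l h : semicrossed phi rho A -> coefs A f ->
  null_coefs phi rho (bop_comp A (bop_comp (mono l h) A)).
Proof.
move=> SA fA; have cA := coefs_comp fA (coefs_comp (coefs_mono phi rho l h) fA).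
exists (cprod phi f (cprod phi (delta l h) f)) => // e e0.
pose c := rnorm h * (rnorm A + rnorm A) + 1.
have c0 : 0 < c by rewrite ltr_wpDl// mulr_ge0 ?addr_ge0 ?rnorm_ge0.
have [N AN] := fejer_cvg SA fA (divr_gt0 e0 c0).
set A' := fejer phi rho N f in AN.
have nA' : rnorm A' <= rnorm A := rnorm_fejer N fA.
pose f' k := (fejer_weight N k)%:C *: f k.
have fA' : coefs A' f' := coefs_fejer phi rho N f.
have cA' := coefs_comp fA' (coefs_comp (coefs_mono phi rho l h) fA').
have f'0 k : (N <= k)%N -> f' k = 0.
  by move=> Nk; rewrite /f' /fejer_weight (eqP Nk) mul0r scale0r.
exists (N + l + N)%N => k kN.
have k0 : cprod phi f' (cprod phi (delta l h) f') k = 0.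
  apply/val_inj/funext => x; rewrite [LHS]cprodE big1// => n _.
  have [nN|Nn] := ltnP n (N + l)%N.
    rewrite f'0 ?mul0r// -(leq_add2r n) subnK; last by rewrite -ltnS.
    by apply: leq_trans kN; rewrite addnC leq_add2r ltnW.
  rewrite cprod_deltal; case: leqP => [ln|_]; last by rewrite mulr0.
  have -> : f' (n - l)%N = 0 by rewrite f'0// -(leq_add2r l) subnK.
  by rewrite /= !mulr0.
have := coefs_norm k (coefsB cA cA'); rewrite k0 subr0 => /le_trans; apply.
apply: le_trans (sandwich_dist _ _ _) _.
apply: le_trans (_ : _ <= e / c * (rnorm A + rnorm A) * rnorm h) _.
  apply: ler_pM; rewrite ?mulr_ge0 ?addr_ge0 ?rnorm_ge0 ?rnorm_mono//.
  by apply: ler_pM; rewrite ?addr_ge0 ?rnorm_ge0 ?lerD// ltW.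
rewrite -mulrA mulrAC -mulrA ler_piMr ?(ltW e0)// ler_pdivrMr// mul1r mulrC.
by rewrite /c lerDl.
Qed.

Lemma orbit_separation (x : X) n (s : seq nat) : metrizable R X ->
  (forall j, j \in s -> iter j phi x <> iter n phi x) ->
  exists2 U, nbhs (iter n phi x) U &
    nbhs x [set y | forall j, j \in s -> ~ U (iter j phi y)].
Proof.
move=> mX; elim: s => [|j s IH] xs.
  by exists setT; [exact: filterT|exact: filterE].
have [|U Un Us] := IH; first by move=> k ks; apply: xs; rewrite inE ks orbT.
have [V [W [Vj Wn VW]]] := metrizable_hausdorff mX (xs j (mem_head _ _)).
exists (U `&` W); first exact: filterI.
have Vx := iter_continuous Vj.
apply: filterS (filterI Us Vx) => y [Uy Vy] k.
by rewrite inE => /orP[/eqP->|/Uy Uk] []// _; exact: VW.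
Qed.

Lemma compact_element_conditions A f : metrizable R X -> locally_compact [set: X] ->
  semicrossed phi rho A -> coefs A f -> compact_element phi rho A ->
  forall m n : nat,
    [/\ forall (l : nat) (x : X), limit_point [set: X] x ->
          f m (iter (n + l)%N phi x) * f n x = 0,
        forall x : X, recurrent phi x -> f m x = 0 &
        equicontinuous [set: nat]
          (fun (l : nat) (x : X) =>
             f m (iter (n + l)%N phi x) * f n x : R[i]^o)].
Proof.
move=> mX lX SA fA cptA.
pose K := [set B | exists l h, rnorm h <= 1 /\ B = bop_comp A (bop_comp (mono l h) A)].
have pK : precompact K.
  apply: precompact_subset cptA => _ [l [h [h1 ->]]]; exists (mono l h) => //.
  split; first exact: semicrossed_mono.
  rewrite /unit_ball/= rnormE (lecR _ 1).
  exact: le_trans (rnorm_mono _ _ _ _) h1.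
have nK B : K B -> null_coefs phi rho B.
  by move=> [l [h [_ ->]]]; exact: sandwich_null_coefs fA.
have coefK l h := coefs_comp fA (coefs_comp (coefs_mono phi rho l h) fA).
have KE l h : rnorm h <= 1 -> K (bop_comp A (bop_comp (mono l h) A)).
  by move=> h1; exists l, h.
(* Of the terms n <= 2m of the coefficient of index 2m + l, those with n < m
   contain f n x, and those with n > m contain a value of f (2m - n) on the
   orbit of x, which consists of recurrent points: all vanish by induction. *)
have rec0 m x : recurrent phi x -> f m x = 0.
  elim/ltn_ind: m x => m IH x rx; apply/rnorm0_eq0/eqP; apply/negPn/negP => fx0.
  pose a := rnorm (f m x); have a0 : 0 < a by rewrite lt_def fx0 rnorm_ge0.
  have a20 : 0 < a / 2 by rewrite divr_gt0.
  have [h [hx _ h1]] := C0_bump mX lX (@filterT _ (nbhs (iter m phi x)) _).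
  have [k0 k0P] := precompact_coefs_null pK nK (mulr_gt0 a20 a20).
  (* The return time q is m + l for the monomial U^l h. *)
  have [q kq fq] := recurrent_return (m + k0) rx (C0_near (f m) x a20).
  have := k0P _ _ (m + m + (q - m))%N (KE (q - m)%N h h1) (coefK _ _) _.
  have mq : (m <= q)%N by apply: leq_trans kq; exact: leq_addr.
  rewrite -addnA subnKC// => /(_ (leq_trans (leq_addl _ _) (leq_trans kq (leq_addl _ _)))).
  move=> /(le_trans (rnorm_C0 _ x)); rewrite -{2}(subnKC mq) addnA sandwich_coefE.
  have mm : (m < (m + m).+1)%N by rewrite ltnS leq_addr.
  rewrite (bigD1 (Ordinal mm))//= big1 => [|n /eqP nm].
    rewrite addr0 addnK subnKC// hx mul1r rnormM leNgt => /negP; apply.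
    rewrite -/a; apply: ltr_pM; rewrite ?(ltW a20)//; last first.
      by rewrite ltr_pdivrMr// mulr_natr mulr2n ltrDl.
    have := rnormD (f m x - f m (iter q phi x)) (f m (iter q phi x)).
    by rewrite subrK -/a => /half_lt; apply.
  have [nm'|mn|nE] := ltngtP n m.
  - by rewrite (IH n)// mulr0 mulr0.
  - rewrite IH ?mul0r//; last exact: recurrent_iter.
    by rewrite ltn_subLR ?ltn_add2r// -ltnS.
  - by case: nm; exact: val_inj.
move=> m n.
pose F l x := f m (iter (n + l)%N phi x) * f n x : R[i]^o.
(* Near a point with injective orbit, a function h supported near phi^n x sees
   only the n-th term of the coefficient of index m + n + l. *)
have isolate x : ~ recurrent phi x ->
    exists2 U, nbhs (iter n phi x) U & nbhs x [set y |
      forall h l, (forall z, ~ U z -> h z = 0) ->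
      cprod phi f (cprod phi (delta l h) f) (m + n + l) y = F l y * h (iter n phi y)].
  move=> nx; have [|U Un Ux] := @orbit_separation x n [seq j <- iota 0 (m + n).+1 | j != n] mX.
    move=> j; rewrite mem_filter => /andP[/eqP jn _] E; apply: jn.
    exact: nonrecurrent_orbit_inj nx E.
  exists U => //; apply: filterS Ux => y Uy h l hU.
  have nmn : (n < (m + n).+1)%N by rewrite ltnS leq_addl.
  rewrite sandwich_coefE (bigD1 (Ordinal nmn))//= addnK big1 ?addr0 => [|j /eqP jn].
    by rewrite /F mulrCA mulrC.
  rewrite hU ?mul0r ?mulr0//; apply: Uy; rewrite mem_filter mem_iota ltn_ord leq0n !andbT.
  by apply/eqP => jE; apply: jn; exact: val_inj.
have Fle l x : rnorm (F l x) <= rnorm (f m) * rnorm (f n x).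
  by rewrite rnormM ler_wpM2r ?rnorm_ge0// rnorm_C0.
split=> [l x xa|x|].
- have [rx|nx] := pselect (recurrent phi x); first by rewrite (rec0 n)// mulr0.
  rewrite -/(F l x); apply/rnorm0_eq0/eqP; rewrite eq_le rnorm_ge0 andbT.
  apply/ler_addgt0Pr => e e0; rewrite add0r; apply: ltW.
  have [U Un Ux] := isolate x nx.
  have [y [yx _ [Uy ey]]] := xa _ (filterI Ux (precompact_coefs_equicontinuous pK nK x e0)).
  (* The bump is one at phi^n x and zero at phi^n y for a point y close to x, so
     the values at x and y of one equicontinuous family are F l x and 0. *)
  have Un' : nbhs (iter n phi x) (U `&` [set z | z <> iter n phi y]).
    apply: filterI Un _; apply: metrizable_nbhs_neq mX _ => /iter_inj E.
    by rewrite E eqxx in yx.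
  have [h [hx hU h1]] := C0_bump mX lX Un'.
  have hU' z : ~ U z -> h z = 0 by move=> Uz; apply: hU => -[].
  have := ey _ _ (m + n + l)%N (KE l h h1) (coefK _ _).
  rewrite (nbhs_singleton Ux)// Uy// hx mulr1 (hU (iter n phi y)).
    by rewrite mulr0 subr0.
  by case.
- exact: rec0.
- move=> x E entE.
  have [e e0 eE] : exists2 e : R, 0 < e & forall z w : R[i]^o, rnorm (z - w) < e -> E (z, w).
    have [d /= d0 dE] : exists2 d : R[i], 0 < d & [set zw | ball zw.1 d zw.2] `<=` E.
      by move: entE; rewrite -entourage_ballE => -[d d0 dE]; exists d.
    have dRe : d = (complex.Re d)%:C by rewrite RRe_real ?gtr0_real.
    exists (complex.Re d) => [|z w zw]; first by rewrite -ltcR -dRe.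
    by apply: dE; rewrite /= -ball_normE/= rnormE dRe ltcR.
  suff : nbhs x [set y | forall l, rnorm (F l x - F l y) < e].
    by apply: filterS => y Fy l _; apply: eE; exact: Fy.
  have M0 : 0 < rnorm (f m) + 1 by rewrite ltr_wpDl ?rnorm_ge0.
  have [rx|nx] := pselect (recurrent phi x).
    apply: filterS (C0_near (f n) x (divr_gt0 e0 M0)) => y /=.
    rewrite (rec0 n x rx) sub0r rnormN ltr_pdivlMr// => fy l.
    rewrite /F (rec0 n x rx) mulr0 sub0r rnormN; apply: le_lt_trans fy.
    by apply: le_trans (Fle l y) _; rewrite mulrC ler_wpM2l ?rnorm_ge0// lerDl.
  have [U Un Ux] := isolate x nx.
  have [h [hx hU h1]] := C0_bump mX lX Un.
  have e20 : 0 < e / 2 by rewrite divr_gt0.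
  pose M := rnorm (f m) * rnorm (f n) + 1.
  have M10 : 0 < M by rewrite ltr_wpDl ?mulr_ge0 ?rnorm_ge0.
  have hn : nbhs x [set y | rnorm (h (iter n phi x) - h (iter n phi y)) < e / 2 / M].
    have := C0_near (iter n (alpha phi) h) x (divr_gt0 e20 M10).
    by apply: filterS => y /=; rewrite !iter_alphaE.
  apply: filterS (filterI (filterI Ux hn) (precompact_coefs_equicontinuous pK nK x e20)).
  move=> y [[Uy hy] ey] l.
  have := ey _ _ (m + n + l)%N (KE l h h1) (coefK _ _).
  rewrite (nbhs_singleton Ux)// Uy// hx mulr1 => Fh.
  apply: le_lt_trans (rnorm_triangle (F l y * h (iter n phi y)) _ _) _.
  rewrite (splitr e); apply: ltr_leD => //.
  have -> : F l y * h (iter n phi y) - F l y = - (F l y * (1 - h (iter n phi y))).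
    by rewrite mulrBr mulr1 opprB.
  rewrite rnormN rnormM.
  apply: le_trans (_ : _ <= M * (e / 2 / M)) _.
    apply: ler_pM; rewrite ?rnorm_ge0//; last by rewrite -hx ltW.
    apply: le_trans (Fle l y) _; apply: le_trans (_ : _ <= rnorm (f m) * rnorm (f n)) _.
      by rewrite ler_wpM2l ?rnorm_ge0 ?rnorm_C0.
    by rewrite lerDl.
  by rewrite mulrC divfK ?gt_eqF.
Qed.

End Necessity.

(** * Totally bounded images and isolated points *)

(** The centres i e - M with 0 <= i <= 2 M / e. *)
Lemma real_net (R : realType) (M e : R) : 0 < e ->
  exists s : seq R, forall x, `|x| <= M -> exists2 y, y \in s & `|x - y| < e.
Proof.
move=> e0; pose N := (Num.truncn ((M + M) / e)).+1.
exists [seq i%:R * e - M | i <- iota 0 N] => x /[!ler_norml] /andP[Mx xM].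
have x0 : 0 <= (x + M) / e by rewrite divr_ge0 ?(ltW e0)// -lerBlDr sub0r.
pose i := Num.truncn ((x + M) / e); exists (i%:R * e - M).
  apply/mapP; exists i => //; rewrite mem_iota /= add0n ltnS le_truncn//.
  by rewrite ler_pM2r ?invr_gt0// lerD2r.
have := truncn_le ((x + M) / e); rewrite x0 -/i ler_pdivlMr// => iM.
have := truncnS_gt ((x + M) / e); rewrite -/i -natr1 ltr_pdivrMr// mulrDl mul1r => Mi.
rewrite opprB addrA ger0_norm ?subr_ge0//.
by rewrite ltrBlDl.
Qed.

Lemma complex_net (R : realType) (M e : R) : 0 < e ->
  exists s : seq R[i]^o, forall z, rnorm z <= M -> exists2 w, w \in s & rnorm (z - w) < e.
Proof.
move=> e0; have e20 : 0 < e / 2 by rewrite divr_gt0.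
have [s sP] := real_net M e20.
exists [seq (a +i* b : R[i]^o) | a <- s, b <- s] => -[x y] zM.
have [a aS xa] := sP x (le_trans (rnorm_Re (x +i* y)) zM).
have [b bS yb] := sP y (le_trans (rnorm_Im (x +i* y)) zM).
exists (a +i* b); first by apply/allpairsP; exists (a, b).
apply: le_lt_trans (rnorm_le_ReIm _) _ => /=.
by rewrite (splitr e) ltrD.
Qed.

Section TotallyBoundedImages.
Context {R : realType} {V : normedModType R[i]} {I : Type} (D : set I).
Implicit Types (P Q : I -> V).

Lemma totally_bounded_add P Q : totally_bounded (P @` D) -> totally_bounded (Q @` D) ->
  totally_bounded ((fun i => P i + Q i) @` D).
Proof.
move=> tP tQ e e0; have e20 : 0 < e / 2 by rewrite divr_gt0.
have [s sP] := tP _ e20; have [r rQ] := tQ _ e20.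
exists [seq a + b | a <- s, b <- r] => _ [i Di <-].
have [|a aS Pa] := sP (P i); first by exists i.
have [|b bS Qb] := rQ (Q i); first by exists i.
exists (a + b); first by apply/allpairsP; exists (a, b).
rewrite opprD addrACA; apply: le_lt_trans (rnormD _ _) _.
by rewrite (splitr e) ltrD.
Qed.

Lemma totally_bounded_sum (J : eqType) (r : seq J) (P : J -> I -> V) :
  (forall j, j \in r -> totally_bounded (P j @` D)) ->
  totally_bounded ((fun i => \sum_(j <- r) P j i) @` D).
Proof.
elim: r => [|j r IH] tP.
  move=> e e0; exists [:: 0] => _ [i _ <-]; exists 0; first exact: mem_head.
  by rewrite big_nil subrr rnorm0.
rewrite (_ : (fun i => _) = fun i => P j i + \sum_(k <- r) P k i); last first.
  by apply/funext => i; rewrite big_cons.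
apply: totally_bounded_add; first exact/tP/mem_head.
by apply: IH => k kr; apply: tP; rewrite inE kr orbT.
Qed.

Lemma totally_bounded_approx P :
  (forall e : R, 0 < e -> exists2 Q, totally_bounded (Q @` D) &
     forall i, D i -> rnorm (P i - Q i) <= e) ->
  totally_bounded (P @` D).
Proof.
move=> aP e e0; have e20 : 0 < e / 2 by rewrite divr_gt0.
have [Q tQ PQ] := aP _ e20; have [s sQ] := tQ _ e20.
exists s => _ [i Di <-]; have [|c cs Qc] := sQ (Q i); first by exists i.
exists c => //; apply: le_lt_trans (rnorm_triangle (Q i) _ _) _.
by rewrite (splitr e) ler_ltD// PQ.
Qed.

Lemma totally_bounded_line P (v : V) (M : R) :
  (forall i, D i -> exists2 c : R[i]^o, rnorm c <= M & P i = c *: v) ->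
  totally_bounded (P @` D).
Proof.
move=> Pv e e0; have c0 : 0 < rnorm v + 1 by rewrite ltr_wpDl ?rnorm_ge0.
have [s sM] := complex_net M (divr_gt0 e0 c0).
exists [seq c *: v | c <- s] => _ [i /Pv[c cM ->] <-].
have [d ds cd] := sM c cM; exists (d *: v); first exact: map_f.
rewrite -scalerBl rnormZ; move: cd; rewrite ltr_pdivlMr//; apply: le_lt_trans.
by rewrite ler_wpM2l ?rnorm_ge0// lerDl.
Qed.

Lemma totally_bounded_scale P (a : R[i]) : totally_bounded (P @` D) ->
  totally_bounded ((fun i => a *: P i) @` D).
Proof.
move=> tP e e0; have c0 : 0 < rnorm (a : R[i]^o) + 1 by rewrite ltr_wpDl ?rnorm_ge0.
have [s sP] := tP _ (divr_gt0 e0 c0).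
exists [seq a *: c | c <- s] => _ [i Di <-].
have [|c cs Pc] := sP (P i); first by exists i.
exists (a *: c); first exact: map_f.
rewrite -scalerBr rnormZ; move: Pc; rewrite ltr_pdivlMr// mulrC; apply: le_lt_trans.
by rewrite ler_wpM2r ?rnorm_ge0// lerDl.
Qed.

End TotallyBoundedImages.

Section IsolatedPoints.
Context {R : realType} {X : topologicalType} (phi : homeomorphism X).
Implicit Types (f g : C0 R X) (x y : X).

Definition open_point x := nbhs x [set x].

Lemma open_point_not_limit x : ~ limit_point [set: X] x -> open_point x.
Proof.
move=> nx; apply: contrapT => nix; apply: nx => U xU; apply: contrapT => nU.
apply: nix; apply: filterS xU => y Uy /=; apply: contrapT => /eqP yx.
by apply: nU; exists y.
Qed.

Lemma open_point_iter n x : open_point x -> open_point (iter n phi x).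
Proof.
elim: n => [//|n IH] /IH ix; rewrite /open_point iterS.
have : homeo_inv phi @ phi (iter n phi x) --> homeo_inv phi (phi (iter n phi x)).
  exact: homeo_inv_continuous.
rewrite homeo_funK => /(_ _ ix).
by rewrite nbhs_simpl /=; apply: filterS => y /= <-; rewrite homeo_invK.
Qed.

Lemma C0_point x : metrizable R X -> open_point x ->
  exists c : C0 R X, forall y, c y = (y == x)%:R.
Proof.
move=> mX ix.
have cP : (fun y => (y == x)%:R : R[i]^o) \in C0_pred.
  apply/C0_predP; split=> [|e e0]; last first.
    exists [set x]; first exact: compact_set1.
    by move=> y /eqP/negPf yx; rewrite yx rnorm0.
  apply/continuous_rnormP => y e e0; have [->|yx] := eqVneq y x.
    by apply: filterS ix => z /= ->; rewrite eqxx subrr rnorm0.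
  have /eqP/(metrizable_nbhs_neq mX) := yx; apply: filterS => z /= /eqP/negPf ->.
  by rewrite subrr rnorm0.
by exists (MkC0 cP).
Qed.

(** The functions chi x are the point masses; without [undup], a repetition in s
    would subtract one of them twice. *)
Lemma C0_cutoff (chi : X -> C0 R X) f (s : seq X) y :
  (forall x, x \in s -> forall z, chi x z = (z == x)%:R) ->
  (f - \sum_(x <- undup s) f x *: chi x) y = if y \in s then 0 else f y.
Proof.
move=> chiE.
have -> : (f - \sum_(x <- undup s) f x *: chi x) y =
    f y - \sum_(x <- undup s) f x * (y == x)%:R.
  congr (_ - _); rewrite big_seq [RHS]big_seq.
  transitivity (\sum_(x <- undup s | x \in undup s) (f x *: chi x) y).
    by elim/big_ind2 : _ => // f1 a f2 b <- <-.
  by apply: eq_bigr => x; rewrite mem_undup => /chiE xE; rewrite -xE.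
have [ys|ys] := boolP (y \in s).
  rewrite (bigD1_seq y) ?undup_uniq ?mem_undup//= eqxx mulr1 big1 ?addr0 ?subrr//.
  by move=> x /negPf xy; rewrite eq_sym xy mulr0.
rewrite big_seq big1 ?subr0// => x; rewrite mem_undup => xs.
by case: eqP => [yx|_]; [rewrite yx xs in ys|rewrite mulr0].
Qed.

End IsolatedPoints.

(** * Sandwiches between monomials *)

Section MonomialSandwiches.
Context {R : realType} {X : topologicalType} (phi : homeomorphism X).
Context {H0 : normedModType R[i]} {dot : hilbert_dot H0}.
Context (rho : faithful_rep X dot).
Implicit Types (f g : C0 R X) (T : bop (ell2 H0)) (x y : X).

Notation coefs := (coefs phi rho).
Notation mono := (mono phi rho).

Lemma mono_linear n : linear (mono n).
Proof.
move=> a f g; apply: coefs_inj (coefs_mono phi rho n _) _.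
apply: eq_coefs (coefsP a (coefs_mono phi rho n f) (coefs_mono phi rho n g)) => k.
by rewrite /delta; case: eqP => // _; rewrite scaler0 addr0.
Qed.

HB.instance Definition _ n :=
  GRing.isLinear.Build R[i] (C0 R X) (bop (ell2 H0)) *:%R (mono n) (mono_linear n).

(** By [coefs_fourier], this contains the unit ball of the semicrossed product;
    the estimates only use the matrix form of T. *)
Definition toeplitz_ball : set (bop (ell2 H0)) :=
  [set T | (exists t, coefs T t) /\ rnorm T <= 1].

Definition sandwich m n f g T : bop (ell2 H0) :=
  bop_comp (mono m f) (bop_comp T (mono n g)).

Lemma sandwichPl m n a f1 f2 g T :
  sandwich m n (a *: f1 + f2) g T = a *: sandwich m n f1 g T + sandwich m n f2 g T.
Proof. by apply/val_inj/funext => x; rewrite /sandwich linearP. Qed.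

Lemma sandwichPr m n a f g1 g2 T :
  sandwich m n f (a *: g1 + g2) T = a *: sandwich m n f g1 T + sandwich m n f g2 T.
Proof.
apply/val_inj/funext => xi.
transitivity (mono m f (T (a *: mono n g1 xi + mono n g2 xi))).
  by rewrite /sandwich linearP.
by rewrite !linearP.
Qed.

Lemma sandwichBl m n f1 f2 g T :
  sandwich m n (f1 - f2) g T = sandwich m n f1 g T - sandwich m n f2 g T.
Proof. by rewrite addrC -scaleN1r sandwichPl scaleN1r addrC. Qed.

Lemma sandwichBr m n f g1 g2 T :
  sandwich m n f (g1 - g2) T = sandwich m n f g1 T - sandwich m n f g2 T.
Proof. by rewrite addrC -scaleN1r sandwichPr scaleN1r addrC. Qed.

Lemma sandwich_suml m n (s : seq X) (a : X -> R[i]) (c : X -> C0 R X) g T :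
  sandwich m n (\sum_(x <- s) a x *: c x) g T = \sum_(x <- s) a x *: sandwich m n (c x) g T.
Proof.
elim: s => [|x s IH]; last by rewrite !big_cons sandwichPl IH.
by rewrite !big_nil -(subrr (0 : C0 R X)) sandwichBl subrr.
Qed.

Lemma sandwich_sumr m n (s : seq X) (a : X -> R[i]) (c : X -> C0 R X) f T :
  sandwich m n f (\sum_(x <- s) a x *: c x) T = \sum_(x <- s) a x *: sandwich m n f (c x) T.
Proof.
elim: s => [|x s IH]; last by rewrite !big_cons sandwichPr IH.
by rewrite !big_nil -(subrr (0 : C0 R X)) sandwichBr subrr.
Qed.

(** The coefficient of index m + n + l at x can be nonzero only if
    phi^(n+l) x = y, and since y is not periodic this happens for at most one l:
    a single monomial remains. *)
Lemma sandwich_points_line m n x y (cx cy : C0 R X) :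
  (forall z, cx z = (z == x)%:R) -> (forall z, cy z = (z == y)%:R) ->
  ~ recurrent phi y -> totally_bounded (sandwich m n cy cx @` toeplitz_ball).
Proof.
move=> cxE cyE ny.
have orbit1 j k : iter j phi x = y -> iter k phi x = y -> j = k.
  wlog jk : j k / (j <= k)%N => [H jy ky|jy ky].
    by have [/H->//|/ltnW/H->] := leqP j k.
  have : iter (k - j) phi y = iter 0 phi y by rewrite -{1}jy -iterD subnK.
  move=> /(nonrecurrent_orbit_inj ny)/eqP; rewrite subn_eq0 => kj.
  by apply/eqP; rewrite eqn_leq jk.
pose coef t k : C0 R X := cprod phi (delta m cy) (cprod phi t (delta n cx)) k.
have coefE t k z : coef t k z = if (m + n <= k)%N then
    (iter (k - m) phi z == y)%:R * t (k - m - n)%N (iter n phi z) * (z == x)%:R else 0.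
  rewrite /coef cprod_deltal; have [mk|km] := leqP m k; last first.
    by rewrite leqNgt (leq_trans km)// leq_addr.
  rewrite cprod_deltar leq_subRL//; case: ifP => _; last by rewrite /= mulr0.
  by rewrite /= !iter_alphaE cyE cxE mulrA.
have coefS T t : coefs T t -> coefs (sandwich m n cy cx T) (coef t).
  move=> tT; apply: coefs_comp; first exact: coefs_mono.
  by apply: coefs_comp => //; exact: coefs_mono.
have tle T t l z : coefs T t -> rnorm T <= 1 -> rnorm (t l z) <= 1.
  move=> tT T1; apply: le_trans (rnorm_C0 _ _) _.
  exact: le_trans (coefs_norm l tT) T1.
have [[l ly]|nl] := pselect (exists l, iter (n + l) phi x = y).
  apply: (@totally_bounded_line _ _ _ _ _ (mono (m + (n + l))%N cx) 1).
  move=> T [[t tT] T1]; exists (t l (iter n phi x)); first exact: tle tT T1.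
  apply: coefs_inj (coefS T t tT) _.
  have := coefsP (t l (iter n phi x)) (coefs_mono phi rho (m + (n + l)) cx) (coefs0 phi rho).
  rewrite addr0; apply: eq_coefs => k; rewrite addr0.
  apply/val_inj/funext => z.
  transitivity (t l (iter n phi x) * delta (m + (n + l)) cx k z) => //.
  rewrite [RHS]coefE /delta; have [->|zx] := eqVneq z x; last first.
    by rewrite mulr0 if_same; case: eqP => _; rewrite ?cxE ?(negPf zx) mulr0.
  rewrite mulr1; have [->|kN] := eqVneq k (m + (n + l))%N.
    rewrite addnA leq_addr cxE eqxx mulr1 -addnA addKn ly eqxx mul1r.
    by rewrite addKn.
  rewrite mulr0; case: ifP => // mnk; case: eqP => [ky|]; last by rewrite mul0r.
  have := orbit1 _ _ ky ly => kE; move: kN.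
  by rewrite -kE subnKC ?eqxx// (leq_trans _ mnk)// leq_addr.
apply: (@totally_bounded_line _ _ _ _ _ 0 1).
move=> T [[t tT] T1]; exists 0; first by rewrite rnorm0.
rewrite scaler0; apply: coefs_inj (coefS T t tT) _.
apply: eq_coefs (coefs0 phi rho) => k; apply/val_inj/funext => z.
transitivity (0 : R[i]) => //; rewrite [RHS]coefE.
case: ifP => // mnk; have [->|_] := eqVneq z x; last by rewrite mulr0.
case: eqP => [ky|_]; last by rewrite !mul0r.
case: nl; exists (k - m - n)%N; rewrite -ky; congr iter.
by rewrite subnKC// leq_subRL// (leq_trans _ mnk)// leq_addr.
Qed.

(** By [rnorm_sandwich], the part of g outside the finite set s contributes at
    most e; what remains of g is a sum of point masses at isolated points x.
    For these the values of f matter only on the orbit of x, and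
    beyond phi^(n+L) x they are small, so f too is reduced to point masses. *)
Lemma sandwich_totally_bounded m n f g : metrizable R X ->
  (forall e : R, 0 < e -> exists2 s : seq X, forall x, x \in s -> open_point x &
     forall x, x \notin s -> forall l, rnorm (f (iter (n + l) phi x) * g x : R[i]^o) <= e) ->
  (forall x (e : R), 0 < e -> exists L, forall l, (L <= l)%N -> rnorm (f (iter l phi x)) <= e) ->
  (forall y, recurrent phi y -> f y = 0) ->
  totally_bounded (sandwich m n f g @` toeplitz_ball).
Proof.
move=> mX fin tail rec0.
have [chi chiE] : exists chi : X -> C0 R X,
    forall x, open_point x -> forall z, chi x z = (z == x)%:R.
  exists (fun x => if pselect (open_point x) is left ix
    then projT1 (cid (C0_point mX ix)) else 0).
  by move=> x ix; case: pselect => // ix'; exact: (projT2 (cid (C0_point mX ix'))).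
have small f' g' (e : R) T : 0 < e -> toeplitz_ball T ->
    (forall x l, rnorm (f' (iter (n + l) phi x) * g' x : R[i]^o) <= e) ->
    rnorm (sandwich m n f' g' T) <= e.
  move=> e0 [[t tT] T1] fge; apply: le_trans (rnorm_sandwich m tT (ltW e0) _) _ => //.
  by rewrite ler_piMr// ltW.
have point x : open_point x -> totally_bounded (sandwich m n f (chi x) @` toeplitz_ball).
  move=> ix; apply: totally_bounded_approx => e e0; have [L fL] := tail x e e0.
  pose s := [seq iter (n + l) phi x | l <- iota 0 L].
  have sI y : y \in s -> open_point y by move=> /mapP[l _ ->]; exact: open_point_iter.
  have cut y := C0_cutoff f y (fun z zs => chiE z (sI z zs)).
  exists (sandwich m n (\sum_(y <- undup s) f y *: chi y) (chi x)).
    rewrite (_ : sandwich _ _ _ _ = fun T =>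
      \sum_(y <- undup s) f y *: sandwich m n (chi y) (chi x) T); last first.
      by apply/funext => T; exact: sandwich_suml.
    apply: totally_bounded_sum => y; rewrite mem_undup => /sI iy.
    have [ry|ny] := pselect (recurrent phi y).
      apply: (@totally_bounded_line _ _ _ _ _ 0 0) => T _.
      by exists 0; [rewrite rnorm0|rewrite rec0// !scale0r].
    by apply: totally_bounded_scale; apply: sandwich_points_line ny; exact: chiE.
  move=> T BT; rewrite -sandwichBl; apply: small => // y l; rewrite chiE//.
  case: eqP => [->|_]; last by rewrite mulr0 rnorm0 ltW.
  rewrite mulr1 cut; case: ifP => [_|/negP lL]; first by rewrite rnorm0 ltW.
  apply: fL; apply: leq_trans (leq_addl n l); rewrite leqNgt; apply/negP => lL'.
  by apply: lL; apply/mapP; exists l => //; rewrite mem_iota.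
apply: totally_bounded_approx => e e0; have [s sI sf] := fin e e0.
have cut y := C0_cutoff g y (fun z zs => chiE z (sI z zs)).
exists (sandwich m n f (\sum_(x <- undup s) g x *: chi x)).
  rewrite (_ : sandwich _ _ _ _ = fun T =>
    \sum_(x <- undup s) g x *: sandwich m n f (chi x) T); last first.
    by apply/funext => T; exact: sandwich_sumr.
  apply: totally_bounded_sum => x; rewrite mem_undup => /sI ix.
  exact/totally_bounded_scale/point.
move=> T BT; rewrite -sandwichBr; apply: small => // x l; rewrite cut.
by case: ifP => [_|/negbT/sf]; [rewrite mulr0 rnorm0 ltW|exact].
Qed.

End MonomialSandwiches.

(** * The conditions imply compactness *)

Section Sufficiency.
Context {R : realType} {X : topologicalType} (phi : homeomorphism X).
Implicit Types (f g : C0 R X) (x y : X).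

Lemma equicontinuous_rnorm (F : nat -> X -> R[i]^o) x (e : R) :
  equicontinuous [set: nat] F -> 0 < e ->
  nbhs x [set y | forall l, rnorm (F l x - F l y) < e].
Proof.
move=> eF e0; have e0' : 0 < e%:C :> R[i] by rewrite ltcR.
have entE : entourage [set zw : R[i]^o * R[i]^o | rnorm (zw.1 - zw.2) < e].
  rewrite -entourage_ballE; exists e%:C => // -[z w] /=.
  by rewrite -ball_normE/= rnormE ltcR.
by apply: filterS (eF x _ entE) => y Fy l; exact: Fy.
Qed.

(** Where g is not small, one works on a compact set.  An accumulation point has a
    neighbourhood on which all the products are small, since they vanish at the
    point and are equicontinuous; any other point is a neighbourhood of
    itself. *)
Lemma finite_large_points n f g (e : R) : 0 < e ->
  (forall l x, limit_point [set: X] x -> f (iter (n + l) phi x) * g x = 0) ->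
  equicontinuous [set: nat] (fun l x => f (iter (n + l) phi x) * g x : R[i]^o) ->
  exists2 s : seq X, forall x, x \in s -> open_point x &
    forall x, x \notin s -> forall l, rnorm (f (iter (n + l) phi x) * g x : R[i]^o) <= e.
Proof.
move=> e0 fg0 fgE; pose F l x := f (iter (n + l) phi x) * g x : R[i]^o.
have c0 : 0 < rnorm f + 1 by rewrite ltr_wpDl ?rnorm_ge0.
have [K cK gK] := C0_vanish g (divr_gt0 e0 c0).
pose U x := if pselect (limit_point [set: X] x) then
  [set y | forall l, rnorm (F l x - F l y) < e] else [set x].
have [|s _ Ks] := compact_finite_nbhs (U := U) cK.
  move=> x _; rewrite /U; case: pselect => xl; last exact: open_point_not_limit.
  exact: equicontinuous_rnorm.
exists [seq x <- s | `[< open_point x >]] => [x|y ys l].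
  by rewrite mem_filter => /andP[/asboolP].
have [/Ks[x xs]|/gK gy] := pselect (K y).
  rewrite /U; case: pselect => [xl Fxy|xl yx].
    by have := Fxy l; rewrite [F l x]fg0// sub0r rnormN => /ltW.
  have {}yx : y = x := yx; have xo := open_point_not_limit xl.
  by move: ys; rewrite yx mem_filter xs andbT => /asboolPn.
apply: le_trans (_ : _ <= (rnorm f + 1) * rnorm (g y)) _.
  rewrite rnormM ler_wpM2r ?rnorm_ge0//.
  by apply: le_trans (rnorm_C0 _ _) _; rewrite lerDl.
by rewrite mulrC -ler_pdivlMr// ltW.
Qed.

(** Otherwise the orbit of x meets the compact set where |f| is large infinitely
    often, and accumulates at some y.  If y is isolated, the orbit passes twice
    through y, which is then periodic, and f y = 0.  If y is an accumulation
    point, take a visit z = phi^j x close to y and a later visit phi^l x: the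
    product of f at these two points is the value at z of a member of the
    equicontinuous family with m = n, which vanishes at y, so it is small. *)
Lemma orbit_vanish m f x (e : R) : 0 < e ->
  (forall l y, limit_point [set: X] y -> f (iter (m + l) phi y) * f y = 0) ->
  (forall y, recurrent phi y -> f y = 0) ->
  equicontinuous [set: nat] (fun l y => f (iter (m + l) phi y) * f y : R[i]^o) ->
  exists L, forall l, (L <= l)%N -> rnorm (f (iter l phi x)) <= e.
Proof.
move=> e0 ff0 rec0 ffE; have [K cK fK] := C0_vanish f e0.
pose good U := exists L, forall l, (L <= l)%N -> U (iter l phi x) ->
  rnorm (f (iter l phi x)) <= e.
have [V VP] : exists V : X -> set X, forall y, nbhs y (V y) /\ good (V y).
  suff h y : exists V, nbhs y V /\ good V.
    by exists (fun y => projT1 (cid (h y))) => y; exact: projT2 (cid (h y)).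
  have [yl|/open_point_not_limit yo] := pselect (limit_point [set: X] y).
    pose V := [set z | forall l, rnorm (f (iter (m + l) phi y) * f y -
      f (iter (m + l) phi z) * f z : R[i]^o) < e ^+ 2].
    exists V; split; first exact: (equicontinuous_rnorm y ffE (exprn_gt0 2 e0)).
    have [[j [Vj fj]]|nj] := pselect (exists j, V (iter j phi x) /\
        e < rnorm (f (iter j phi x))); last first.
      exists 0%N => l _ Vl; rewrite leNgt; apply/negP => fl.
      by apply: nj; exists l.
    exists (m + j)%N => l jl _; rewrite leNgt; apply/negP => fl.
    have := Vj (l - j - m)%N; rewrite ff0// sub0r rnormN -iterD.
    have -> : (m + (l - j - m) + j = l)%N.
      by rewrite subnKC ?subnK// ?leq_subRL 1?addnC// (leq_trans _ jl)// leq_addl.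
    rewrite rnormM ltNge expr2 => /negP; apply.
    by apply: ler_pM; rewrite ?(ltW e0) ?ltW.
  exists [set y]; split=> //.
  have [[j jy]|nj] := pselect (exists j, iter j phi x = y); last first.
    by exists 0%N => l _ ly; case: nj; exists l.
  exists j.+1 => l jl /= ly; rewrite ly rec0 ?rnorm0 ?(ltW e0)//.
  apply: (@periodic_recurrent _ phi (l - j)); first by rewrite subn_gt0.
  by rewrite -{1}jy -iterD subnK// ltnW.
have [|s _ Ks] := compact_finite_nbhs (U := V) cK.
  by move=> y _; exact: (VP y).1.
have [L LP] : exists L, forall y l, y \in s -> (L <= l)%N -> V y (iter l phi x) ->
    rnorm (f (iter l phi x)) <= e.
  elim: s {Ks} => [|y s [L1 IH]]; first by exists 0%N.
  have [L2 L2P] := (VP y).2; exists (maxn L1 L2) => z l.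
  by rewrite inE geq_max => /orP[/eqP->|zs] /andP[l1 l2]; [exact: L2P|exact: IH].
exists L => l Ll; have [/Ks[y ys Vy]|/fK/ltW//] := pselect (K (iter l phi x)).
exact: LP ys Ll Vy.
Qed.

Context {H0 : normedModType R[i]} {dot : hilbert_dot H0}.
Context (rho : faithful_rep X dot).

Lemma conditions_totally_bounded (A : bop (ell2 H0)) (f : nat -> C0 R X) :
  metrizable R X -> semicrossed phi rho A -> coefs phi rho A f ->
  (forall m n : nat,
    [/\ forall (l : nat) (x : X), limit_point [set: X] x ->
          f m (iter (n + l)%N phi x) * f n x = 0,
        forall x : X, recurrent phi x -> f m x = 0 &
        equicontinuous [set: nat]
          (fun (l : nat) (x : X) =>
             f m (iter (n + l)%N phi x) * f n x : R[i]^o)]) ->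
  totally_bounded ((fun T => bop_comp A (bop_comp T A)) @` toeplitz_ball phi rho).
Proof.
move=> mX SA fA cond; apply: totally_bounded_approx => e e0.
pose c := rnorm A + rnorm A + 1.
have c0 : 0 < c by rewrite ltr_wpDl// addr_ge0 ?rnorm_ge0.
have [N AN] := fejer_cvg SA fA (divr_gt0 e0 c0).
set A' := fejer phi rho N f in AN.
have nA' : rnorm A' <= rnorm A := rnorm_fejer N fA.
exists (fun T => bop_comp A' (bop_comp T A')); last first.
  move=> T [_ T1]; apply: le_trans (sandwich_dist _ _ _) _.
  apply: le_trans (_ : _ <= e / c * c * 1) _; last by rewrite mulr1 divfK ?gt_eqF.
  apply: ler_pM; rewrite ?mulr_ge0 ?addr_ge0 ?rnorm_ge0//.
  apply: ler_pM; rewrite ?addr_ge0 ?rnorm_ge0 ?ltW//.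
  by apply: le_lt_trans (lerD (lexx _) nA') _; rewrite ltrDl.
have sumE (r : seq 'I_N) T B :
    bop_comp (\sum_(m <- r) (fejer_weight N m)%:C *: mono phi rho m (f m)) (bop_comp T B) =
    \sum_(m <- r) (fejer_weight N m)%:C *: bop_comp (mono phi rho m (f m)) (bop_comp T B).
  elim: r => [|m r IH]; first by rewrite !big_nil; exact/val_inj/funext.
  by rewrite !big_cons -IH; exact/val_inj/funext.
have sumEr (r : seq 'I_N) S T :
    bop_comp S (bop_comp T (\sum_(n <- r) (fejer_weight N n)%:C *: mono phi rho n (f n))) =
    \sum_(n <- r) (fejer_weight N n)%:C *: bop_comp S (bop_comp T (mono phi rho n (f n))).
  have lin a P Q : bop_comp S (bop_comp T (a *: P + Q)) =
      a *: bop_comp S (bop_comp T P) + bop_comp S (bop_comp T Q).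
    apply/val_inj/funext => v; transitivity (S (T (a *: P v + Q v))) => //.
    by rewrite !linearP.
  elim: r => [|n r IH]; last by rewrite !big_cons lin IH.
  rewrite !big_nil; apply/val_inj/funext => v.
  by transitivity (S (T 0)) => //; rewrite !linear0.
rewrite (_ : (fun T => _) = fun T => \sum_(m <- index_enum 'I_N) (fejer_weight N m)%:C *:
    \sum_(n <- index_enum 'I_N) (fejer_weight N n)%:C *: sandwich phi rho m n (f m) (f n) T).
  apply: totally_bounded_sum => m _; apply: totally_bounded_scale.
  apply: totally_bounded_sum => n _; apply: totally_bounded_scale.
  have [c1 _ c3] := cond m n; have [d1 c2 d3] := cond m m.
  apply: sandwich_totally_bounded => // [d d0|x d d0].
    exact: finite_large_points.
  exact: (orbit_vanish x d0 d1 c2 d3).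
apply/funext => T; rewrite sumE; apply: eq_bigr => m _; congr (_ *: _).
exact: sumEr.
Qed.

End Sufficiency.

Theorem corollary2p7 (R : realType) (X : topologicalType)
    (X_metrizable : metrizable R X) (X_lc : locally_compact [set: X])
    (phi : homeomorphism X)
    (H0 : completeNormedModType R[i]) (dot : hilbert_dot H0)
    (rho : faithful_rep X dot)
    (A : bop (ell2 H0)) (A_in : semicrossed phi rho A) :
  let f (m : nat) : C0 R X := fourier_coef phi rho m A in
  compact_element phi rho A <->
  (forall m n : nat,
    [/\ forall (l : nat) (x : X), limit_point [set: X] x ->
          f m (iter (n + l)%N phi x) * f n x = 0,
        forall x : X, recurrent phi x -> f m x = 0 &
        equicontinuous [set: nat]
          (fun (l : nat) (x : X) =>
             f m (iter (n + l)%N phi x) * f n x : R[i]^o)]).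
Proof.
move=> f; have fA := coefs_fourier A_in; split=> [cptA|cond].
  exact: (compact_element_conditions X_metrizable X_lc A_in fA cptA).
have tb := conditions_totally_bounded X_metrizable A_in fA cond.
apply: totally_bounded_precompact.
  exact/bop_complete/ell2_complete/complete_norm_complete.
move=> e /tb[s sP]; exists s => _ [T [ST T1] <-]; apply: sP; exists T => //.
split; first by eexists; exact: coefs_fourier ST.
by move: T1; rewrite /unit_ball/= rnormE (lecR _ 1).
Qed.
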